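(* Let $k(t)$ be any positive function with $k(t)\to\infty$ and $k(t)=o(t)$ as $t\to\infty$. Consider the Crump–Mode–Jagers branching process generated by a random walk $(S_n)$ whose increments $\xi$ are exponentially distributed with unit mean, and let $Y^{(j)}_m$ and $U_m(t)=t^m/m!$ be as in the context. Then, as $t\to\infty$, $$\bigg(\frac{[k(t)]^{1/2}([k(t)u]-1)!}{t^{[k(t)u]-1/2}}\sum_{j\geq 1}\big(Y^{(j)}_{[k(t)u]-1}(t-S_j)-U_{[k(t)u]-1}(t-S_j)\big)\mathbf{1}_{\{S_j\leq t\}}\bigg)_{u>0}$$ converges in the sense of finite-dimensional distributions to the zero process.
   Context: Let $(\xi_k)_{k\in\mathbb{N}}$ be i.i.d. copies of a positive random variable $\xi$ (here exponential with mean $1$), and $S_n=\xi_1+\dots+\xi_n$. The CMJ process: at time $0$ there is one individual (the ancestor), which produces first-generation offspring at birth times given by the point process $\sum_{n\ge1}\delta_{S_n}$; each individual born at time $s$ produces its own children at times $s+$(points of an independent copy of this point process); all individuals act independently. For $k\in\mathbb{N}$, $Y_k(t)$ is the number of $k$-th generation individuals with birth times $\le t$. For $i\in\mathbb{N}$ and $m\ge1$, $Y^{(i)}_m(t)$ is the number of $(m+1)$-st generation descendants of the first-generation individual born at time $S_i$ that are born in $[S_i,S_i+t]$; the processes $(Y^{(i)}_m(t))_{t\ge0}$, $i\in\mathbb{N}$, are independent copies of $(Y_m(t))_{t\ge 0}$, independent of $(S_n)$. $U_m(t):=\mathbb{E}Y_m(t)$, which in the exponential case equals $t^m/m!$ for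 $t\ge0$. $[x]$ is the integer part of $x$. For each fixed $u>0$ the expression is considered for $t$ large enough that $[k(t)u]\ge 2$. *)

(* Defs.v *)
From HB Require Import structures.
From mathcomp Require Import all_boot all_order all_algebra.
From mathcomp Require Import all_classical all_reals all_analysis.
Set Implicit Arguments. Unset Strict Implicit. Unset Printing Implicit Defensive.
Import Order.TTheory GRing.Theory Num.Theory.
Import numFieldNormedType.Exports.
Local Open Scope classical_set_scope.
Local Open Scope ring_scope.

(* Ulam--Harris labelling of the CMJ genealogy.  An individual is a label
   v : seq nat; the root (ancestor) is [::], and the children of w are
   rcons w c, c = 0,1,2,...  (c is the 0-based birth rank).
   xi (rcons w c) is the (c+1)-st increment of the random walk attached to w,
   so the (c+1)-st child of w is born at time
   birth w + xi (rcons w 0) + ... + xi (rcons w c). *)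
Definition birth {R : realType} (xi : seq nat -> R) (v : seq nat) : R :=
  \sum_(l < size v) \sum_(c < (nth 0%N v l).+1) xi (rcons (take l v) c).

(* S_n = xi_1 + ... + xi_n, where xi_k = xi [:: k-1] (increments of the
   ancestor's walk);  S n = birth xi [:: n.-1] for n >= 1. *)
Definition Swalk {R : realType} (xi : seq nat -> R) (n : nat) : R :=
  \sum_(k < n) xi [:: nat_of_ord k].

(* Y_m(t): number of m-th generation individuals born in [0,t] (as an
   extended real; finite a.s.). *)
Definition Ygen {R : realType} (xi : seq nat -> R) (m : nat) (t : R) : \bar R :=
  \esum_(v in [set v : seq nat | size v = m /\ birth xi v <= t]) 1%E.

(* The subtree rooted at the first-generation individual [:: i]
   (born at S_{i+1}), relabelled so that it is a CMJ process of its own. *)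
Definition subtree {R : realType} (xi : seq nat -> R) (i : nat) : seq nat -> R :=
  fun v => xi (i :: v).

(* Y^{(j)}_m(t), j >= 1: the (m+1)-st generation descendants of the
   first-generation individual born at S_j, born in [S_j, S_j + t]. *)
Definition Ysub {R : realType} (xi : seq nat -> R) (j m : nat) (t : R) : \bar R :=
  Ygen (subtree xi j.-1) m t.

Definition Um {R : realType} (m : nat) (t : R) : R := t ^+ m / (m`!)%:R.

(* The series over j >= 1 (index i = j-1) is the limit of its partial sums;
   a.s. only finitely many terms are nonzero since S_j -> oo. *)
Definition Xproc {R : realType} (k : R -> R) (xi : seq nat -> R) (t u : R) : R :=
  let M := Num.truncn (k t * u) in
  Num.sqrt (Num.truncn (k t))%:R * ((M.-1)`!)%:R / powR t (M%:R - 2^-1) *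
  limn (fun n => \sum_(0 <= i < n)
     ((fine (Ysub xi i.+1 M.-1 (t - Swalk xi i.+1)) - Um M.-1 (t - Swalk xi i.+1))
       * (if Swalk xi i.+1 <= t then 1 else 0))).

Definition mutually_independent {d} {Omega : measurableType d} {R : realType}
  (P : probability Omega R) {I : choiceType} (X : I -> Omega -> R) : Prop :=
  forall (s : seq I) (A : I -> set R), uniq s -> (forall i, measurable (A i)) ->
  P (\bigcap_(i in [set` s]) (X i @^-1` A i)) =
  (\prod_(i <- s) P (X i @^-1` A i))%E.

Definition cvg_dist_const {d} {Omega : measurableType d} {R : realType}
  (P : probability Omega R) (n : nat) (Z : R -> Omega -> 'rV[R]_n) (c : 'rV[R]_n) : Prop :=
  forall f : 'rV[R]_n -> R, continuous f -> (exists M : R, forall x, `|f x| <= M) ->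
  (\int[P]_w (f (Z t w))%:E)%E @[t --> +oo] --> (f c)%:E.

(* Main.v *)
Require Import Defs.
From HB Require Import structures.
From mathcomp Require Import all_boot all_order all_algebra.
From mathcomp Require Import all_classical all_reals all_analysis.
From mathcomp Require Import measurable_realfun ring lra zify.
Import Order.TTheory GRing.Theory Num.Theory.
Import numFieldNormedType.Exports.
Set Implicit Arguments. Unset Strict Implicit. Unset Printing Implicit Defensive.
Local Open Scope classical_set_scope.
Local Open Scope ring_scope.

(** Put f_p(t) = t^p/p! for t >= 0 and f_p(t) = 0 for t < 0.  If x is a standard
    exponential variable then E f_p(t-x) + E f_{p+1}(t-x) = f_{p+1}(t), and
    telescoping along the walk gives sum_n E f_p(t - S_n) = f_{p+1}(t).  Splitting
    a label into its first letter and the rest, and using that the walk of the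
    ancestor and the subtrees of its children are independent, one gets by
    induction E Y_m(t) = f_m(t) and
    E Y_m(t)^2 <= sum_{j <= m} C(2j,j) f_{m+j}(t).  In the centred sum of the
    theorem the cross terms cancel, so its second moment is at most
    sum_i E Var Y_m(t - S_i) <= sum_{j < m} C(2j,j) f_{m+j+1}(t).  For m = o(t)
    the last term dominates geometrically, and after multiplication by the squared
    normalisation the bound is at most 2 k(t)/t, which tends to 0. *)

(** * Independence and decoupling *)

(** [Xproc] contains a limit of partial sums and is not known to be measurable, so a Chebyshev bound
    is not applied to it directly. All moment bounds concern sums over the first N children, with a
    right-hand side free of N; then N is chosen, after t, so that S_N > t outside an event of small
    probability. Outside that event and the null event of a negative increment, the series equals
    its N-th partial sum, and a bounded test function is compared with a constant off a measurable
    exceptional event. Independence enters as decoupling: two independent families of increments may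
    be read at separate outcomes w1 and w2, integrated one after the other. This takes the place of
    conditional expectation. Counts may be infinite, so the moments live in the extended reals;
    identities that call for subtraction are stated additively, and terms are cancelled only once
    they are known to be finite. *)

Section independence.
Context {d : measure_display} {Omega : measurableType d} {R : realType}.
Variable P : probability Omega R.

(** The hypothesis on rectangles identifies the law of [(f, g)] with the product of the two laws,
    and Tonelli applies. The result is pulled back to [Omega], so that both integration variables
    are outcomes. *)
Lemma ge0_integral_indep d1 d2 (T1 : measurableType d1) (T2 : measurableType d2)
    (f : Omega -> T1) (g : Omega -> T2) (F : T1 * T2 -> \bar R) :
  measurable_fun setT f -> measurable_fun setT g ->
  (forall A B, measurable A -> measurable B ->
    P ((f @^-1` A) `&` (g @^-1` B)) = (P (f @^-1` A) * P (g @^-1` B))%E) ->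
  measurable_fun setT F -> (forall x, 0 <= F x)%E ->
  (\int[P]_w F (f w, g w) = \int[P]_w1 \int[P]_w2 F (f w1, g w2))%E.
Proof.
move=> mf mg fg mF F0.
pose X : {RV P >-> T1} := mfun_Sub (mem_set mf).
pose Y : {RV P >-> T2} := mfun_Sub (mem_set mg).
have mZ : measurable_fun setT (fun w => (f w, g w)) by exact: measurable_fun_pair.
pose Z : {RV P >-> (T1 * T2)%type} := mfun_Sub (mem_set mZ).
rewrite -[LHS](ge0_integral_distribution Z)//.
rewrite (eq_measure_integral (distribution P X \x distribution P Y)%E); last first.
  by move=> A mA _; apply/esym/product_measure_unique => // *; exact: fg.
rewrite fubini_tonelli1// ge0_integral_distribution//; last 2 first.
- exact: measurable_fun_fubini_tonelli_F.
- by move=> x; apply: integral_ge0 => ? _; exact: F0.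
apply: eq_integral => w _ /=.
rewrite /fubini_F ge0_integral_distribution//.
by move/measurableT_comp : mF; apply; exact: measurable_pair1.
Qed.

(** A pi-system generating the sigma-algebra of the [X i] with [i] in [D], shaped so that
    [mutually_independent] applies to its members as they stand. *)
Definition cylinders {I : choiceType} (X : I -> Omega -> R) (D : set I) :
    set (set Omega) :=
  [set C | exists (s : seq I) (A : I -> set R), [/\ uniq s, [set` s] `<=` D,
    forall i, measurable (A i) & C = \bigcap_(i in [set` s]) (X i @^-1` A i)]].

(** With this coarser sigma-algebra on [Omega], depending only on the variables indexed by [D]
    becomes plain [measurable_fun], and pairs carry the product sigma-algebra. *)
Definition cyl_type {I : choiceType} (X : I -> Omega -> R) (D : set I) :=
  g_sigma_algebraType (cylinders X D).

HB.instance Definition _ {I : choiceType} (X : I -> Omega -> R) (D : set I) :=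
  Measurable.on (cyl_type X D).

(** The events independent of a fixed [B] form a lambda-system, so Dynkin's theorem applies. *)
Lemma indep_sigma_algebra (G : set (set Omega)) (B : set Omega) :
  setI_closed G -> G `<=` measurable -> measurable B ->
  (forall A, G A -> P (A `&` B) = (P A * P B)%E) ->
  forall A, <<s G >> A -> P (A `&` B) = (P A * P B)%E.
Proof.
move=> IG Gm mB GB.
have mG A : <<s G >> A -> measurable A.
  by apply: smallest_sub => //; exact: sigma_algebra_measurable.
apply: (@dynkin_induction _ (g_sigma_algebraType G) G
  [set A | P (A `&` B) = (P A * P B)%E]) => //=.
- by rewrite setTI probability_setT mul1e.
- move=> A /mG mA AB.
  have PBA : P (B `\` A) = (P B - P (A `&` B))%E.
    rewrite measureD//; last by rewrite (le_lt_trans (probability_le1 _ _))// ltry.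
    by rewrite setIC.
  rewrite probability_setC// setIC -setDE PBA [X in (_ - X)%E]AB.
  have [a ->] : exists a, P A = a%:E.
    by exists (fine (P A)); rewrite fineK// fin_num_measure.
  have [b ->] : exists b, P B = b%:E.
    by exists (fine (P B)); rewrite fineK// fin_num_measure.
  by rewrite -EFinM -!EFinB -EFinM mulrBl mul1r.
- move=> F mF tF FB; rewrite setI_bigcupl measure_bigcup//=; last 2 first.
  + by move=> n _; apply: measurableI => //; exact: mG (mF n).
  + exact: trivIset_setIr.
  rewrite measure_bigcup//=; last by move=> n _; exact: mG (mF n).
  have [b Eb] : exists b, P B = b%:E.
    by exists (fine (P B)); rewrite fineK// fin_num_measure.
  rewrite Eb muleC -nneseriesZl//.
  by apply: eq_eseriesr => n _; rewrite muleC -Eb -FB.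
Qed.

Lemma cylinder_measurable {I : choiceType} (X : I -> Omega -> R) (D : set I) :
  (forall i, measurable_fun setT (X i)) -> cylinders X D `<=` measurable.
Proof.
move=> mX _ [s [A [_ _ mA ->]]].
apply: fin_bigcap_measurable => // i _.
by rewrite -[X in measurable X]setTI; exact: mX.
Qed.

Lemma cylinders_setI_closed {I : choiceType} (X : I -> Omega -> R) (D : set I) :
  setI_closed (cylinders X D).
Proof.
move=> _ _ [s [A [us sD mA ->]]] [s' [A' [us' sD' mA' ->]]].
exists (undup (s ++ s')).
exists (fun i => (if i \in s then A i else setT) `&` (if i \in s' then A' i else setT)).
split.
- exact: undup_uniq.
- by move=> i /=; rewrite mem_undup mem_cat => /orP[/sD|/sD'].
- by move=> i; apply: measurableI; case: ifP.
- apply/seteqP; split=> [w [h h'] i /=|w h].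
    rewrite mem_undup mem_cat => _; split; case: ifP => // ii.
      exact: h.
    exact: h'.
  split=> i /= ii; have := h i; rewrite /= mem_undup mem_cat ii ?orbT => /(_ isT)[//=].
Qed.

(** The one-sided extension is used twice, for [A] and then for [B], which leaves two cylinders. *)
Lemma indep_cylinders {I : choiceType} (X : I -> Omega -> R) (D1 D2 : set I) :
  mutually_independent P X -> (forall i, measurable_fun setT (X i)) ->
  D1 `&` D2 = set0 ->
  forall A B, <<s cylinders X D1 >> A -> <<s cylinders X D2 >> B ->
    P (A `&` B) = (P A * P B)%E.
Proof.
move=> indX mX D0 A B sA sB.
have mB : measurable B.
  move: B sB; apply: smallest_sub; first exact: sigma_algebra_measurable.
  exact: cylinder_measurable.
move: A sA; apply: indep_sigma_algebra => //.
- exact: cylinders_setI_closed.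
- exact: cylinder_measurable.
move=> A cA; rewrite setIC muleC; have mA := cylinder_measurable mX cA.
move: B sB {mB}; apply: indep_sigma_algebra => //.
- exact: cylinders_setI_closed.
- exact: cylinder_measurable.
move=> B; move: cA => [s [A1 [us sD mA1 ->]]] [s' [A2 [us' sD' mA2 ->]]].
(* Disjointness of [D1] and [D2] lets the two families be glued, so that the intersection is a
   single cylinder over [s ++ s']. *)
pose A3 i := if i \in s then A1 i else A2 i.
have s's i : i \in s' -> (i \in s) = false.
  move=> is'; apply/negP => iis; have : (D1 `&` D2) i by split; [exact: sD|exact: sD'].
  by rewrite D0.
have mA3 i : measurable (A3 i) by rewrite /A3; case: ifP.
rewrite [X in P X](_ : _ = \bigcap_(i in [set` s ++ s']) (X i @^-1` A3 i)); last first.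
  apply/seteqP; split => [w [h2 h1] i /=|w h].
    rewrite mem_cat /A3; case: ifP => [iis _|_ /= iis]; first exact: h1.
    exact: h2.
  split=> i /= ii; have := h i; rewrite /= mem_cat ii ?orbT /A3 => /(_ isT).
    by rewrite s's.
  by rewrite ii.
rewrite indX//; last first.
  rewrite cat_uniq us us' /= andbT; apply/hasPn => i; rewrite /= => is'.
  by rewrite s's.
rewrite big_cat/= muleC !indX//; congr (_ * _)%E.
  by rewrite !big_seq; apply: eq_bigr => i is'; rewrite /A3 s's.
by rewrite !big_seq; apply: eq_bigr => i is'; rewrite /A3 is'.
Qed.

Lemma measurable_cyl_type {I : choiceType} (X : I -> Omega -> R) (D : set I) i :
  D i -> measurable_fun setT (X i : cyl_type X D -> R).
Proof.
move=> Di _ A mA; rewrite setTI; apply: sub_gen_smallest.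
exists [:: i]; exists (fun=> A); split => //; first by move=> j /=; rewrite inE => /eqP ->.
apply/seteqP; split => [w h j /=|w]; first by rewrite inE => /eqP ->.
by move=> /(_ i); apply; rewrite /= inE.
Qed.

(** The identity of [Omega], seen as a map to [cyl_type X D1] and as a map to [cyl_type X D2], gives
    two independent random elements. *)
Lemma ge0_integral_decouple {I : choiceType} (X : I -> Omega -> R) (D1 D2 : set I)
    (F : cyl_type X D1 * cyl_type X D2 -> \bar R) :
  mutually_independent P X -> (forall i, measurable_fun setT (X i)) ->
  D1 `&` D2 = set0 ->
  measurable_fun setT F -> (forall x, 0 <= F x)%E ->
  (\int[P]_w F (w, w) = \int[P]_w1 \int[P]_w2 F (w1, w2))%E.
Proof.
move=> indX mX D0 mF F0.
have mid D : measurable_fun setT (fun w : Omega => w : cyl_type X D).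
  move=> _ A; rewrite setTI preimage_id; apply: smallest_sub.
    exact: sigma_algebra_measurable.
  exact: cylinder_measurable.
apply: (ge0_integral_indep (f := fun w => w : cyl_type X D1)
   (g := fun w => w : cyl_type X D2)) => //.
by move=> A B mA mB; rewrite !preimage_id; exact: (indep_cylinders indX mX D0).
Qed.

End independence.

(** * Truncated powers and the exponential law *)

Section density.
Context {d : measure_display} {T : measurableType d} {R : realType}.
Local Open Scope ereal_scope.
Import HBNNSimple.
Variables (mu nu : {measure set T -> \bar R}) (h : T -> R).
Hypotheses (mh : measurable_fun setT h) (h0 : forall x, (0 <= h x)%R).
Hypothesis nuE : forall A, measurable A -> nu A = \int[mu]_(x in A) (h x)%:E.

Let nnsfun_density (f : {nnsfun T >-> R}) :
  \int[nu]_x (f x)%:E = \int[mu]_x ((f x)%:E * (h x)%:E).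
Proof.
under [RHS]eq_integral => x _.
  rewrite fimfunE -fsumEFin// ge0_mule_fsuml; last first.
    by move=> r; rewrite EFinM nnfun_muleindic_ge0.
  over.
rewrite /= ge0_integral_fsum//=; last 2 first.
- move=> r; apply: emeasurable_funM; apply/measurable_EFinP => //.
  exact: measurableT_comp.
- by move=> y x _; apply: mule_ge0; rewrite ?EFinM ?nnfun_muleindic_ge0// lee_fin.
under [LHS]eq_integral do rewrite fimfunE -fsumEFin//.
rewrite [LHS]ge0_integral_fsum//; last 2 first.
- by move=> r; exact/measurable_EFinP/measurableT_comp.
- by move=> n x _; rewrite EFinM nnfun_muleindic_ge0.
apply: eq_fsbigr => r /set_mem[x _ <-].
under [RHS]eq_integral do rewrite EFinM -muleA.
under [LHS]eq_integral do rewrite EFinM.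
have mf : measurable (f @^-1` [set f x]) by exact: measurable_sfunP.
rewrite ge0_integralZl//; last 2 first.
- by apply/measurable_EFinP; exact: measurable_indic.
- by rewrite lee_fin.
rewrite ge0_integralZl//; last 3 first.
- by apply: emeasurable_funM; apply/measurable_EFinP => //; exact: measurable_indic.
- by move=> y _; apply: mule_ge0 => //; rewrite lee_fin.
- by rewrite lee_fin.
congr (_ * _); rewrite integral_indic// setIT nuE// integral_mkcond.
apply: eq_integral => y _; rewrite epatch_indic muleC//.
Qed.

(** Linearity settles simple functions; monotone convergence gives the rest. *)
Lemma ge0_integral_density (f : T -> \bar R) :
  measurable_fun setT f -> (forall x, 0 <= f x) ->
  \int[nu]_x f x = \int[mu]_x (f x * (h x)%:E).
Proof.
move=> mf f0; pose f_ := nnsfun_approx measurableT mf.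
transitivity (limn (fun n => \int[nu]_x (f_ n x)%:E)).
  rewrite -monotone_convergence//=.
  - by apply: eq_integral => x _; apply/esym/cvg_lim => //=; exact: cvg_nnsfun_approx.
  - by move=> n; exact/measurable_EFinP.
  - by move=> n ? _; rewrite lee_fin.
  - by move=> ? _ ? ? mn; rewrite lee_fin; exact/lefP/nd_nnsfun_approx.
under eq_fun do rewrite nnsfun_density.
rewrite -monotone_convergence//=.
- apply: eq_integral => x _; apply/cvg_lim => //=.
  under eq_fun do rewrite muleC. rewrite muleC.
  by apply: cvgeZl => //; exact: cvg_nnsfun_approx.
- by move=> n; apply: emeasurable_funM => //; exact/measurable_EFinP.
- by move=> n ? _; rewrite mule_ge0// lee_fin.
- by move=> x _ ? ? mn; rewrite lee_wpmul2r ?lee_fin//; exact/lefP/nd_nnsfun_approx.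
Qed.
End density.

Section truncated_powers.
Context {R : realType}.

(* The mean of Y_p(t). *)
Definition tpow (p : nat) (t : R) : R := if 0 <= t then t ^+ p / p`!%:R else 0.

Lemma tpow_ge0 p t : 0 <= tpow p t.
Proof. by rewrite /tpow; case: ifPn => // t0; rewrite divr_ge0// exprn_ge0. Qed.

Lemma measurable_tpow p : measurable_fun setT (tpow p).
Proof.
apply: measurable_fun_if => //=; first exact: measurable_fun_ler.
apply: measurable_funM => //; exact/measurable_funX.
Qed.

(** Turns products back into single truncated powers, to which the walk estimates apply linearly.
    The central binomials of the moment bounds are the case [p = q]. *)
Lemma tpowM p q t : tpow p t * tpow q t = 'C(p + q, p)%:R * tpow (p + q) t.
Proof.
rewrite /tpow; case: ifPn => t0; last by rewrite !mulr0.
rewrite exprD -(bin_fact (leq_addr q p)) addKn !natrM.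
have h n : (n`!%:R : R) != 0 by rewrite pnatr_eq0 -lt0n fact_gt0.
have b : ('C(p + q, p)%:R : R) != 0 by rewrite pnatr_eq0 -lt0n bin_gt0 leq_addr.
by field; rewrite b !h.
Qed.

(** The two integrals are evaluated together: f_p is the derivative of f_{p+1}, so on [0, t] the
    total integrand is the derivative of -f_{p+1}(t-x) e^{-x}, which vanishes at x = t. *)
Lemma integral_exp_tpow p t :
  (\int[lebesgue_measure]_x ((tpow p (t - x))%:E * (exponential_pdf 1 x)%:E) +
  \int[lebesgue_measure]_x ((tpow p.+1 (t - x))%:E * (exponential_pdf 1 x)%:E) =
  (tpow p.+1 t)%:E)%E.
Proof.
have mt q : measurable_fun setT (fun x : R => (tpow q (t - x))%:E * (exponential_pdf 1 x)%:E)%E.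
  apply: emeasurable_funM; apply/measurable_EFinP.
    by apply: (measurableT_comp (measurable_tpow q)); exact: measurable_funB.
  exact: measurable_exponential_pdf.
have pos q x : (0 <= (tpow q (t - x))%:E * (exponential_pdf 1 x)%:E)%E.
  by rewrite mule_ge0 ?lee_fin ?tpow_ge0 ?exponential_pdf_ge0.
rewrite -ge0_integralD//; try exact: mt.
have [t0|t0] := ltP t 0.
  rewrite [tpow _ t]/tpow leNgt t0/= integral0_eq// => x _.
  have [x0|x0] := ltP x 0; first by rewrite lt0_exponential_pdf// !mule0 adde0.
  by rewrite /tpow leNgt subr_lt0 (lt_le_trans t0 x0) !mul0e adde0.
pose f (x : R) : R := ((t - x) ^+ p / p`!%:R + (t - x) ^+ p.+1 / p.+1`!%:R) * expR (- x).
transitivity (\int[lebesgue_measure]_(x in `[0%R, t]) (f x)%:E)%E.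
  rewrite [RHS]integral_mkcond/=; apply: eq_integral => x _; rewrite patchE.
  case: ifPn => [|]; rewrite ?inE ?notin_setE/= in_itv/=.
    move=> /andP[x0 xt]; rewrite -EFinM -EFinM -EFinD /tpow subr_ge0 xt -mulrDl.
    by rewrite exponential_pdfE// mul1r mulN1r.
  have [x0 _|x0 /= /negP xt] := ltP x 0; first by rewrite lt0_exponential_pdf// !mule0 adde0.
  by rewrite /tpow subr_ge0 (negbTE xt) !mul0e adde0.
(* The fundamental theorem of calculus is applied below on a nondegenerate interval. *)
have [->|tn0] := eqVneq t 0.
  by rewrite set_itv1 integral_set1 /tpow lexx expr0n/= mul0r.
have tp : 0 < t by rewrite lt_neqAle eq_sym tn0.
pose F (x : R) : R := - ((t - x) ^+ p.+1 / p.+1`!%:R * expR (- x)).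
have dF x : is_derive x (1:R) F (f x).
  have dE : is_derive x (1:R) (fun x : R => expR (- x)) (- expR (- x)).
    apply: is_derive_eq. by rewrite /GRing.scale/= mulrN1.
  have dL : is_derive x (1:R) (fun x : R => t - x) (-1).
    have := is_deriveB (is_derive_cst t x (1 : R)) (is_derive_id x (1 : R)).
    by rewrite sub0r.
  have dP : is_derive x (1:R) (fun x : R => (t - x) ^+ p.+1) (- (p.+1%:R * (t - x) ^+ p)).
    have := is_deriveX p.+1 dL.
    by rewrite scalerN /GRing.scale/= mulr1 exprfctE.
  have := is_deriveN (is_deriveZ (p.+1`!%:R^-1) (is_deriveM dP dE)).
  rewrite [X in is_derive _ _ X _](_ : _ = F); last first.
    by apply/funext => y; rewrite /F [in RHS]mulrAC [in RHS]mulrC.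
  congr is_derive; rewrite /f /GRing.scale/= factS natrM.
  have h1 : (p`!%:R : R) != 0 by rewrite pnatr_eq0 -lt0n fact_gt0.
  have h2 : (p.+1%:R : R) != 0 by rewrite pnatr_eq0.
  rewrite exprS; move: (p.+1%:R : R) h2 (p`!%:R : R) h1 => a a0 b b0.
  by field; rewrite a0 b0.
have cF : continuous F.
  move=> x; apply: differentiable_continuous; apply/derivable1_diffP.
  exact: ex_derive.
rewrite (@continuous_FTC2 _ f F)//.
- have -> : F t = 0 by rewrite /F subrr expr0n/= !mul0r oppr0.
  by rewrite sub0e /F subr0 oppr0 expR0 mulr1 EFinN oppeK /tpow t0.
- apply: continuous_subspaceT => x; apply: cvgM; last first.
    by apply: continuous_comp; [exact: opp_continuous|exact: continuous_expR].
  have cP q : (fun x : R => (t - x) ^+ q) x @[x --> x] --> (t - x) ^+ q.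
    apply: (@continuous_comp _ _ _ (fun x : R => t - x) (fun y => y ^+ q)).
      by apply: cvgB; [exact: cvg_cst|exact: cvg_id].
    exact: exprn_continuous.
  by apply: cvgD; apply: cvgM; [exact: cP|exact: cvg_cst|exact: cP|exact: cvg_cst].
- split.
  + by move=> z _; exact: ex_derive.
  + exact/cvg_at_right_filter/cF.
  + exact/cvg_at_left_filter/cF.
- by move=> x _; rewrite derive1E; exact: derive_val.
Qed.
End truncated_powers.

(** * Exponential random walks *)

Section iid_exponential.
Context {d : measure_display} {Omega : measurableType d} {R : realType}.
Variable P : probability Omega R.

Definition iid_exp {I : choiceType} (X : I -> Omega -> R) : Prop :=
  [/\ forall i, measurable_fun setT (X i),
    forall i (A : set R), measurable A -> P (X i @^-1` A) = exponential_prob 1 A &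
    mutually_independent P X].

Lemma iid_exp_reindex {I J : choiceType} (X : I -> Omega -> R) (h : J -> I) :
  injective h -> iid_exp X -> iid_exp (X \o h).
Proof.
move=> hI [mX eX iX]; split=> [i|i|s A us mA]; [exact: mX|exact: eX|].
(* As [h] is injective, this intersection is [A j] at [h j] for [j] in [s], and the full set at
   every other index. *)
pose A' i := \bigcap_(j in [set` s] `&` (h @^-1` [set i])) A j.
have A'h j : j \in s -> A' (h j) = A j.
  move=> js; apply/seteqP; split => [x|x Ax k [_ /hI ->//]].
  by apply; split.
have /(iX (map h s)) H : uniq (map h s) by rewrite map_inj_uniq.
transitivity (P (\bigcap_(i in [set` map h s]) (X i @^-1` A' i))).
  congr (P _); apply/seteqP; split => [w H0 i /mapP[j js ->]|w H0 j js].
    by rewrite /= A'h//; exact: H0.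
  by rewrite /= -A'h//; apply: H0; exact: map_f.
rewrite H; last first.
  move=> i; apply: fin_bigcap_measurable => //.
  by apply: (@sub_finite_set _ _ [set` s]); [exact: subIsetl|exact: finite_seq].
by rewrite big_map !big_seq; apply: eq_bigr => j js; rewrite A'h.
Qed.

Lemma ge0_integral_exp (X : Omega -> R) (f : R -> \bar R) :
  measurable_fun setT X ->
  (forall A : set R, measurable A -> P (X @^-1` A) = exponential_prob 1 A) ->
  measurable_fun setT f -> (forall x, 0 <= f x)%E ->
  (\int[P]_w f (X w) = \int[lebesgue_measure]_x (f x * (exponential_pdf 1 x)%:E))%E.
Proof.
move=> mX eX mf f0.
have mX' : measurable_fun setT (X : Omega -> measurableTypeR R) by exact: mX.
pose Y : {RV P >-> measurableTypeR R} :=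
  @mfun_Sub _ _ Omega (measurableTypeR R) X (mem_set mX').
transitivity (\int[distribution P Y]_y f y)%E.
  by rewrite (ge0_integral_distribution Y).
apply: (@ge0_integral_density _ (measurableTypeR R) R lebesgue_measure
  (distribution P Y) (exponential_pdf 1)) => //.
- exact: measurable_exponential_pdf.
- by move=> x; exact: exponential_pdf_ge0.
Qed.

Lemma integral_tpow_exp (X : Omega -> R) p t :
  measurable_fun setT X ->
  (forall A : set R, measurable A -> P (X @^-1` A) = exponential_prob 1 A) ->
  (\int[P]_w (tpow p (t - X w))%:E + \int[P]_w (tpow p.+1 (t - X w))%:E =
  (tpow p.+1 t)%:E)%E.
Proof.
move=> mX eX.
have mt q : measurable_fun setT (fun x : R => (tpow q (t - x))%:E).
  apply/measurable_EFinP; apply: (measurableT_comp (measurable_tpow q)).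
  exact: measurable_funB.
have t0 q (x : R) : (0 <= (tpow q (t - x))%:E)%E by rewrite lee_fin tpow_ge0.
rewrite (ge0_integral_exp mX eX (mt p))// (ge0_integral_exp mX eX (mt p.+1))//.
exact: integral_exp_tpow.
Qed.

Lemma integral_prob_cst (c : R) : (\int[P]_w c%:E = c%:E)%E.
Proof.
rewrite integral_cst// -[RHS]mule1; congr (_ * _)%E; exact: probability_setT.
Qed.

Section walk.
Variable x : nat -> Omega -> R.
Hypothesis hx : iid_exp x.

Let S n w : R := \sum_(k < n) x k w.

Let mx k : measurable_fun setT (x k). Proof. by case: hx. Qed.

Let mS n : measurable_fun setT (S n).
Proof. by apply: measurable_sum => k; exact: mx. Qed.

(** Decoupling the last increment from the first [n] reduces this to the exponential identity at
    time [t - S n]. The form is additive because finiteness is not yet known. *)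
Lemma walk_tpow_step p t n :
  (\int[P]_w (tpow p (t - S n.+1 w))%:E + \int[P]_w (tpow p.+1 (t - S n.+1 w))%:E =
   \int[P]_w (tpow p.+1 (t - S n w))%:E)%E.
Proof.
pose D1 : set nat := [set k | (k < n)%N]; pose D2 : set nat := [set n].
pose G q (w : cyl_type x D1 * cyl_type x D2) : \bar R :=
  (tpow q (t - (\sum_(k < n) x k w.1 + x n w.2)))%:E.
have mG q : measurable_fun setT (G q).
  apply/measurable_EFinP; apply: (measurableT_comp (measurable_tpow q)).
  apply: measurable_funB => //; apply: measurable_funD.
    apply: measurable_sum => k.
    apply: (measurableT_comp (f := x k : cyl_type x D1 -> R)) => //.
    by apply: measurable_cyl_type; rewrite /D1/=.
  apply: (measurableT_comp (f := x n : cyl_type x D2 -> R)) => //.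
  exact: measurable_cyl_type.
have G0 q w : (0 <= G q w)%E by rewrite lee_fin tpow_ge0.
have D0 : D1 `&` D2 = set0.
  by apply/seteqP; split => // k [/= kn ek]; move: kn; rewrite /D1 (ek : k = n) /= ltnn.
have dec q : (\int[P]_w (tpow q (t - S n.+1 w))%:E =
    \int[P]_w \int[P]_w' (tpow q (t - S n w - x n w'))%:E)%E.
  have [_ _ ix] := hx.
  have := ge0_integral_decouple ix mx D0 (mG q) (G0 q); rewrite /G/= => E.
  under eq_integral do rewrite /S big_ord_recr/=.
  rewrite E; apply: eq_integral => w _; apply: eq_integral => w' _.
  by rewrite opprD addrA.
have [_ ex _] := hx.
have mi q : measurable_fun setT
    (fun w => \int[P]_w' (tpow q (t - S n w - x n w'))%:E)%E.
  apply: (@measurable_fun_fubini_tonelli_F _ _ _ _ _ P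
    (fun w => (tpow q (t - S n w.1 - x n w.2))%:E)).
    apply/measurable_EFinP; apply: (measurableT_comp (measurable_tpow q)).
    apply: measurable_funB; last exact: (measurableT_comp (mx n)).
    by apply: measurable_funB => //; exact: (measurableT_comp (mS n)).
  by move=> w; rewrite lee_fin tpow_ge0.
rewrite !dec -ge0_integralD//.
- apply: eq_integral => w _.
  by rewrite /= (integral_tpow_exp p (t - S n w) (mx n) (ex n)).
- by move=> w _; apply: integral_ge0 => w' _; rewrite lee_fin tpow_ge0.
- by move=> w _; apply: integral_ge0 => w' _; rewrite lee_fin tpow_ge0.
Qed.

(** In the step identity, nonnegative terms with a finite sum are finite, so finiteness passes from
    [(p.+1, n)] to [(p, n.+1)]. *)
Lemma walk_tpow_fin p t n :
  exists2 e : R, 0 <= e & (\int[P]_w (tpow p (t - S n w))%:E = e%:E)%E.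
Proof.
elim: n p => [|n IHn] p.
  exists (tpow p t); first exact: tpow_ge0.
  under eq_integral do rewrite /S big_ord0 subr0.
  by rewrite integral_prob_cst.
have [e e0 E] := IHn p.+1; have := walk_tpow_step p t n.
have I0 q : (0 <= \int[P]_w (tpow q (t - S n.+1 w))%:E)%E.
  by apply: integral_ge0 => w _; rewrite lee_fin tpow_ge0.
rewrite E; move: (I0 p) (I0 p.+1).
case: (integral P _ _) => [a| |]//=; last by case: (integral P _ _).
by rewrite lee_fin; exists a.
Qed.

Let e p t n : R := fine (\int[P]_w (tpow p (t - S n w))%:E).

Let eE p t n : (\int[P]_w (tpow p (t - S n w))%:E = (e p t n)%:E)%E.
Proof. by rewrite /e; have [a _ ->] := walk_tpow_fin p t n. Qed.

Let e_ge0 p t n : 0 <= e p t n.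
Proof. by rewrite /e; have [a ? ->] := walk_tpow_fin p t n. Qed.

Let e_sum p t n : \sum_(k < n) e p t k.+1 + e p.+1 t n = tpow p.+1 t.
Proof.
elim: n => [|n IHn].
  rewrite big_ord0 add0r /e; under eq_integral do rewrite /S big_ord0 subr0.
  by rewrite integral_prob_cst.
rewrite big_ord_recr/= -addrA -[RHS]IHn; congr (_ + _).
by have := walk_tpow_step p t n; rewrite !eE => -[].
Qed.

(** For every [p] these are the terms of a nonnegative series with partial sums at most
    [tpow p.+1 t]. Taken at [p.+1], this removes the remainder of the telescoping sum. *)
Let e_cvg p t : e p t n @[n --> \oo] --> 0.
Proof.
have bs : forall n, series (fun k => e p t k.+1) n <= tpow p.+1 t.
  by move=> n; rewrite -(e_sum p t n) /series/= big_mkord lerDl.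
have : cvgn (series (fun k => e p t k.+1)).
  apply: nondecreasing_is_cvgn.
    by apply: nondecreasing_series => k _ _; exact: e_ge0.
  by exists (tpow p.+1 t) => _ [n _ <-].
by move/cvg_series_cvg_0; rewrite (cvg_shiftS (fun k => e p t k)).
Qed.

Lemma walk_tpow_sum_le p t n :
  (\sum_(k < n) \int[P]_w (tpow p (t - S k.+1 w))%:E <= (tpow p.+1 t)%:E)%E.
Proof.
under eq_bigr do rewrite eE.
by rewrite sumEFin lee_fin -(e_sum p t n) lerDl.
Qed.

Lemma walk_tpow_sum p t :
  (\sum_(k <oo) \int[P]_w (tpow p (t - S k.+1 w))%:E = (tpow p.+1 t)%:E)%E.
Proof.
apply/cvg_lim => //.
rewrite [X in X @ _ --> _](_ : _ = (fun n => (tpow p.+1 t - e p.+1 t n)%:E)); last first.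
  apply/funext => n; under eq_bigr do rewrite eE.
  by rewrite sumEFin big_mkord -(e_sum p t n) addrK.
apply: cvg_EFin; first by apply: nearW.
by rewrite -[X in _ --> X]subr0; apply: cvgB; [exact: cvg_cst|exact: e_cvg].
Qed.

(** f_0(t - S_n) is the indicator of S_n <= t, so the tail probability is [e 0 t n]. *)
Lemma walk_tail_cvg t : (P [set w | (S n w <= t)%R] @[n --> \oo] --> 0)%E.
Proof.
rewrite [X in X @ _ --> _](_ : _ = (fun n => (e 0 t n)%:E)); last first.
  apply/funext => n; rewrite -eE -[X in P X]setIT -integral_indic//; last first.
    by rewrite -[X in measurable X]setTI; exact: measurable_fun_le.
  apply: eq_integral => w _; rewrite indicE /tpow subr_ge0.
  have -> : (w \in [set w | S n w <= t]) = (S n w <= t) by apply/idP/idP; rewrite inE.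
  by case: ifP; rewrite // expr0 divr1.
by apply: cvg_EFin; [exact: nearW|exact: e_cvg].
Qed.

End walk.
End iid_exponential.

(** * Genealogy and first moments *)

Section genealogy.
Context {R : realType}.
Implicit Types xi : seq nat -> R.

Lemma birth_cons xi i v :
  birth xi (i :: v) = Swalk xi i.+1 + birth (subtree xi i) v.
Proof. by rewrite /birth big_ord_recl. Qed.

Lemma birth_ge0 xi v : (forall u, 0 <= xi u) -> 0 <= birth xi v.
Proof. by move=> xi0; apply: sumr_ge0 => l _; apply: sumr_ge0 => c _. Qed.

Lemma Ygen_ge0 xi m t : (0 <= Ygen xi m t)%E.
Proof. by apply: esum_ge0 => v _; rewrite lee_fin. Qed.

Lemma Ygen0 xi t : Ygen xi 0 t = (tpow 0 t)%:E.
Proof.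
rewrite /Ygen /tpow expr0 divr1; case: ifPn => t0.
  rewrite [X in esum X](_ : _ = [set [::]]) ?esum_set1//.
  apply/seteqP; split => [v [/size0nil ->]//|_ ->].
  by split=> //; rewrite /birth big_ord0.
rewrite [X in esum X](_ : _ = set0) ?esum_set0//.
apply/seteqP; split => // v [/size0nil ->].
by rewrite /birth big_ord0 => t0'; rewrite t0' in t0.
Qed.

Lemma YgenS xi m t :
  Ygen xi m.+1 t = (\sum_(i <oo) Ygen (subtree xi i) m (t - Swalk xi i.+1))%E.
Proof.
rewrite nneseries_esumT; last by move=> i; exact: Ygen_ge0.
rewrite esum_esum; last by move=> *; rewrite lee_fin.
rewrite /Ygen; apply: (reindex_esum _ _ (fun p : nat * seq nat => p.1 :: p.2)).
split.
- move=> [i v] /= [_ [sv bv]]; split; first by rewrite sv.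
  by rewrite birth_cons -lerBrDl.
- by move=> [i v] [j u] _ _ [-> ->].
- move=> [[]//|i v [[sv] bv]]; exists (i, v) => //; split=> //=; split => //.
  by rewrite lerBrDl -birth_cons.
Qed.

Lemma Ygen_lt0 xi m t : (forall u, 0 <= xi u) -> t < 0 -> Ygen xi m t = 0%E.
Proof.
move=> xi0 t0; rewrite /Ygen [X in esum X](_ : _ = set0) ?esum_set0//.
apply/seteqP; split => // v [_ bv].
by have := le_lt_trans bv t0; rewrite ltNge birth_ge0.
Qed.

Lemma measurable_Swalk d (T : measurableType d) (xi : seq nat -> T -> R) n :
  (forall k, measurable_fun setT (xi [:: k])) ->
  measurable_fun setT (fun w => Swalk (xi^~ w) n).
Proof. by move=> mxi; apply: measurable_sum => k; exact: mxi. Qed.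

(** Joint measurability in outcome and time is required because the time will be the random t - S_i.
    The label [[::]] is excepted since in the shifted family [xi (i :: v)] it is a step of the
    ancestor's walk, outside the sigma-algebra of the subtrees. *)
Lemma measurable_Ygen_pair d (T : measurableType d) (xi : seq nat -> T -> R) m :
  (forall v, v != [::] -> measurable_fun setT (xi v)) ->
  measurable_fun setT (fun wt : T * R => Ygen (xi^~ wt.1) m wt.2).
Proof.
elim: m xi => [|m IHm] xi mxi.
  under eq_fun do rewrite Ygen0.
  by apply/measurable_EFinP; apply: (measurableT_comp (measurable_tpow 0)).
under eq_fun do rewrite YgenS.
apply: ge0_emeasurable_sum => [i w _ _|i _]; first exact: Ygen_ge0.
apply: (measurableT_comp (IHm (fun v => xi (i :: v)) (fun v _ => mxi (i :: v) isT))
  (g := fun wt : T * R => (wt.1, wt.2 - Swalk (xi^~ wt.1) i.+1))).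
apply: measurable_fun_pair => //; apply: measurable_funB => //.
apply: (measurableT_comp (f := fun w => Swalk (xi^~ w) i.+1)) => //.
by apply: measurable_Swalk => k; exact: mxi.
Qed.

Lemma measurable_Ygen d (T : measurableType d) d' (T' : measurableType d')
    (xi : seq nat -> T -> R) m (f : T' -> T) (g : T' -> R) :
  (forall v, v != [::] -> measurable_fun setT (xi v)) ->
  measurable_fun setT f -> measurable_fun setT g ->
  measurable_fun setT (fun w => Ygen (xi^~ (f w)) m (g w)).
Proof.
move=> mxi mf mg.
apply: (measurableT_comp (measurable_Ygen_pair m mxi) (g := fun w => (f w, g w))).
exact: measurable_fun_pair.
Qed.

End genealogy.

(** * Means, and the independence of walk and subtrees *)

Section moments.
Context {d : measure_display} {Omega : measurableType d} {R : realType}.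
Variable P : probability Omega R.
Implicit Types xi : seq nat -> Omega -> R.

Lemma iid_exp_walk xi : iid_exp P xi -> iid_exp P (fun k : nat => xi [:: k]).
Proof. by apply: (iid_exp_reindex (h := fun k => [:: k])) => i j []. Qed.

Lemma iid_exp_subtree xi i : iid_exp P xi -> iid_exp P (fun v => xi (i :: v)).
Proof. by apply: (iid_exp_reindex (h := cons i)) => u v []. Qed.

(** [birth] reads no increment at the root, so these two index sets carry the whole process. The
    variable [xi [:: i]] belongs to the walk, although its label is the root of a subtree. *)
Let walkI : set (seq nat) := [set v | size v = 1].
Let treeI : set (seq nat) := [set v | (1 < size v)%N].

Let walk_tree_disj : walkI `&` treeI = set0.
Proof. by apply/seteqP; split => // v []; rewrite /walkI /treeI /= => ->. Qed.

(* Y^{(i+1)}_m(t - S_{i+1}), with the ancestor's walk read in [w1] and the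
   subtree of its i-th child read in [w2]. *)
Definition branch xi m t i (w1 w2 : Omega) : \bar R :=
  Ygen (fun v => xi (i :: v) w2) m (t - Swalk (xi^~ w1) i.+1).

Lemma branch_ge0 xi m t i w1 w2 : (0 <= branch xi m t i w1 w2)%E.
Proof. exact: Ygen_ge0. Qed.

Lemma measurable_branch xi m t i : (forall v, measurable_fun setT (xi v)) ->
  measurable_fun setT (fun w => branch xi m t i w w).
Proof.
move=> mxi; apply: (measurable_Ygen (xi := fun v => xi (i :: v))) => //.
by apply: measurable_funB => //; exact: measurable_Swalk.
Qed.

Lemma measurable_walk_sub xi i : (forall v, measurable_fun setT (xi v)) ->
  measurable_fun setT (fun w : cyl_type xi walkI * cyl_type xi treeI =>
    Swalk (xi^~ w.1) i).
Proof.
move=> mxi.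
apply: (measurableT_comp (f := (fun w => Swalk (xi^~ w) i) : cyl_type xi walkI -> R)) => //.
by apply: measurable_Swalk => k; exact: measurable_cyl_type.
Qed.

Lemma measurable_branch_sub xi m t i : (forall v, measurable_fun setT (xi v)) ->
  measurable_fun setT (fun w : cyl_type xi walkI * cyl_type xi treeI =>
    branch xi m t i w.1 w.2).
Proof.
move=> mxi.
apply: (measurable_Ygen (T := cyl_type xi treeI) (xi := fun v => xi (i :: v))) => //.
  by move=> v v0; apply: measurable_cyl_type; case: v v0.
by apply: measurable_funB => //; exact: measurable_walk_sub.
Qed.

Lemma decouple_walk xi (F : Omega -> Omega -> \bar R) : iid_exp P xi ->
  measurable_fun setT
    (fun w : cyl_type xi walkI * cyl_type xi treeI => F w.1 w.2) ->
  (forall w1 w2, 0 <= F w1 w2)%E ->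
  (\int[P]_w F w w = \int[P]_w1 \int[P]_w2 F w1 w2)%E.
Proof.
move=> [mxi _ ixi] mF F0.
exact: (ge0_integral_decouple ixi mxi walk_tree_disj mF (fun w => F0 w.1 w.2)).
Qed.

Lemma measurable_tpow_walk xi m t i : (forall v, measurable_fun setT (xi v)) ->
  measurable_fun setT (fun w => (tpow m (t - Swalk (xi^~ w) i))%:E).
Proof.
move=> mxi; apply/measurable_EFinP; apply: (measurableT_comp (measurable_tpow m)).
by apply: measurable_funB => //; exact: measurable_Swalk.
Qed.

Lemma integral_Ygen xi m t : iid_exp P xi ->
  (\int[P]_w Ygen (xi^~ w) m t = (tpow m t)%:E)%E.
Proof.
elim: m xi t => [|m IHm] xi t hxi.
  under eq_integral do rewrite Ygen0.
  exact: integral_prob_cst.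
have [mxi _ _] := hxi.
under eq_integral do rewrite YgenS.
rewrite (integral_nneseries P measurableT (f := fun i w => branch xi m t i w w)); last 2 first.
- by move=> i; exact: measurable_branch.
- by move=> *; exact: branch_ge0.
rewrite -(walk_tpow_sum (iid_exp_walk hxi)).
apply: eq_eseriesr => i _.
rewrite (decouple_walk (xi := xi) (F := branch xi m t i))//; last 2 first.
- exact: measurable_branch_sub.
- by move=> *; exact: branch_ge0.
by apply: eq_integral => w _; rewrite (IHm (fun v => xi (i :: v)))//; exact: iid_exp_subtree.
Qed.

(** Given the walk, distinct subtrees are independent, so each factor may be replaced by its
    conditional mean. *)
Lemma integral_branch2 xi m t i j : iid_exp P xi -> i != j ->
  (\int[P]_w (branch xi m t i w w * branch xi m t j w w) =
   \int[P]_w ((tpow m (t - Swalk (xi^~ w) i.+1))%:E *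
              (tpow m (t - Swalk (xi^~ w) j.+1))%:E))%E.
Proof.
move=> hxi ij; have [mxi _ ixi] := hxi.
rewrite (decouple_walk (xi := xi)
  (F := fun w1 w2 => branch xi m t i w1 w2 * branch xi m t j w1 w2)%E)//;
  last 2 first.
- by apply: emeasurable_funM; exact: measurable_branch_sub.
- by move=> *; apply: mule_ge0; exact: branch_ge0.
apply: eq_integral => w _; rewrite /branch.
set s := (t - Swalk _ i.+1)%R; set s' := (t - Swalk _ j.+1)%R.
(* The walk is now frozen at [w]; a second decoupling separates labels by their first letter. *)
pose D k : set (seq nat) := [set v | exists u, v = k :: u].
have mY k r : measurable_fun setT
    (fun w : cyl_type xi (D k) => Ygen (fun v => xi (k :: v) w) m r).
  apply: (@measurable_Ygen R _ (cyl_type xi (D k)) _ (cyl_type xi (D k))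
    (fun v => xi (k :: v)) m idfun (fun=> r)).
  - by move=> v v0; apply: measurable_cyl_type; exists v.
  - exact: measurable_id.
  - exact: measurable_cst.
have mY' k r : measurable_fun setT (fun w => Ygen (fun v => xi (k :: v) w) m r).
  apply: (@measurable_Ygen R _ _ _ _ (fun v => xi (k :: v)) m idfun (fun=> r)).
  - by [].
  - exact: measurable_id.
  - exact: measurable_cst.
have D0 : D i `&` D j = set0.
  by apply/seteqP; split => // v [/= [u ->] [u' [ij']]]; rewrite ij' eqxx in ij.
have mF : measurable_fun setT (fun w : cyl_type xi (D i) * cyl_type xi (D j) =>
   Ygen (fun v => xi (i :: v) w.1) m s * Ygen (fun v => xi (j :: v) w.2) m s')%E.
  apply: emeasurable_funM.
    exact: (measurableT_comp (mY i s)).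
  exact: (measurableT_comp (mY j s')).
have F0 (z : cyl_type xi (D i) * cyl_type xi (D j)) :
   (0 <= Ygen (fun v => xi (i :: v) z.1) m s * Ygen (fun v => xi (j :: v) z.2) m s')%E.
  by apply: mule_ge0; exact: Ygen_ge0.
rewrite (ge0_integral_decouple ixi mxi D0 mF F0)/=.
under eq_integral => w1 _.
  rewrite ge0_integralZl//; [|by move=> *; exact: Ygen_ge0|exact: Ygen_ge0].
  rewrite (integral_Ygen _ _ (iid_exp_subtree j hxi)); over.
rewrite /= ge0_integralZr//; [|by move=> *; exact: Ygen_ge0|by rewrite lee_fin tpow_ge0].
by rewrite (integral_Ygen _ _ (iid_exp_subtree i hxi)).
Qed.

(** The second factor is a function of the walk, so only the subtree is averaged; this covers
    [i = j] as well. *)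
Lemma integral_branch_walk xi m t i j : iid_exp P xi ->
  (\int[P]_w (branch xi m t i w w * (tpow m (t - Swalk (xi^~ w) j.+1))%:E) =
   \int[P]_w ((tpow m (t - Swalk (xi^~ w) i.+1))%:E *
              (tpow m (t - Swalk (xi^~ w) j.+1))%:E))%E.
Proof.
move=> hxi; have [mxi _ ixi] := hxi.
rewrite (decouple_walk (xi := xi) (F := fun w1 w2 => branch xi m t i w1 w2 *
   (tpow m (t - Swalk (xi^~ w1) j.+1))%:E)%E)//; last 2 first.
- apply: emeasurable_funM; first exact: measurable_branch_sub.
  apply/measurable_EFinP; apply: (measurableT_comp (measurable_tpow m)).
  by apply: measurable_funB => //; exact: measurable_walk_sub.
- by move=> *; apply: mule_ge0; rewrite ?branch_ge0// lee_fin tpow_ge0.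
apply: eq_integral => w _.
rewrite ge0_integralZr//; last 3 first.
- apply: (@measurable_Ygen R _ _ _ _ (fun v => xi (i :: v)) m idfun
    (fun=> (t - Swalk (xi^~ w) i.+1)%R)).
  + by [].
  + exact: measurable_id.
  + exact: measurable_cst.
- by move=> *; exact: branch_ge0.
- by rewrite lee_fin tpow_ge0.
by rewrite (integral_Ygen _ _ (iid_exp_subtree i hxi)).
Qed.

End moments.

(** * Second moments *)

Section ereal_sums.
Context {R : realType}.
Local Open Scope ereal_scope.

Lemma sum_triangle (G : nat -> nat -> \bar R) N : (forall i j, G i j = G j i) ->
  \sum_(0 <= i < N) \sum_(0 <= j < N) G i j =
  \sum_(0 <= i < N) G i i + (\sum_(0 <= i < N) \sum_(i.+1 <= j < N) G i j +
                             \sum_(0 <= i < N) \sum_(i.+1 <= j < N) G i j).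
Proof.
move=> Gs; elim: N => [|N IHN]; first by rewrite !big_geq// !adde0.
have tri : \sum_(0 <= i < N.+1) \sum_(i.+1 <= j < N.+1) G i j =
    \sum_(0 <= i < N) \sum_(i.+1 <= j < N) G i j + \sum_(0 <= i < N) G i N.
  rewrite big_nat_recr//= [X in _ + X]big_geq// adde0 -big_split/=.
  by apply: eq_big_nat => i /andP[_ iN]; rewrite big_nat_recr.
rewrite tri big_nat_recr//= [X in _ + X]big_nat_recr//=.
under eq_bigr do rewrite big_nat_recr//=.
rewrite big_split/= IHN [in RHS]big_nat_recr//=.
under [X in _ + (X + _) = _]eq_bigr do rewrite Gs.
rewrite [X in _ = _ + X]addeACA -!addeA; congr (_ + _).
rewrite [RHS]addeC -!addeA; congr (_ + _); congr (_ + _); congr (_ + _).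
Qed.

(** The square of a difference with the cross term moved to the left, which remains true for
    [A = +oo], where both sides are infinite. *)
Lemma sqr_sub_add (A : \bar R) (B : R) : 0 <= A -> (0 <= B)%R ->
  (A - B%:E) * (A - B%:E) + (A * B%:E + A * B%:E) = A * A + B%:E * B%:E.
Proof.
case: A => [a| |]// A0 B0.
  by rewrite -EFinB -!EFinM -!EFinD; congr EFin; ring.
have -> : +oo - B%:E = +oo :> \bar R by [].
rewrite mulyy addye; last first.
  by rewrite gt_eqF// (lt_le_trans ltNy0)// adde_ge0// mule_ge0// lee_fin.
by rewrite -EFinM addye.
Qed.

Lemma integral_sumM d (T : measurableType d) (mu : {measure set T -> \bar R})
    (f g : nat -> T -> \bar R) N :
  (forall i, measurable_fun setT (f i)) -> (forall i, measurable_fun setT (g i)) ->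
  (forall i x, 0 <= f i x) -> (forall i x, 0 <= g i x) ->
  \int[mu]_x ((\sum_(0 <= i < N) f i x) * (\sum_(0 <= j < N) g j x)) =
  \sum_(0 <= i < N) \sum_(0 <= j < N) \int[mu]_x (f i x * g j x).
Proof.
move=> mf mg f0 g0.
under eq_integral => x _.
  rewrite ge0_sume_distrl//; under eq_bigr do rewrite ge0_sume_distrr//; over.
rewrite /= ge0_integral_sum//; last 2 first.
- move=> i; apply: emeasurable_sum => j; exact: emeasurable_funM.
- by move=> i x _; apply: sume_ge0 => j _; exact: mule_ge0.
apply: eq_bigr => i _; rewrite ge0_integral_sum//.
- by move=> j; exact: emeasurable_funM.
- by move=> j x _; exact: mule_ge0.
Qed.

End ereal_sums.

(** * Products of truncated powers at two points of the walk *)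

Section walk_pairs.
Context {d : measure_display} {Omega : measurableType d} {R : realType}.
Variable P : probability Omega R.
Variable x : nat -> Omega -> R.
Hypothesis hx : iid_exp P x.
Local Notation S n w := (\sum_(k < n) x k w).

Let mx k : measurable_fun setT (x k). Proof. by case: hx. Qed.

Let mS n : measurable_fun setT (fun w => S n w).
Proof. by apply: measurable_sum => k; exact: mx. Qed.

Let mtS p t n : measurable_fun setT (fun w => (tpow p (t - S n w))%:E).
Proof.
apply/measurable_EFinP; apply: (measurableT_comp (measurable_tpow p)).
exact: measurable_funB.
Qed.

(** After step [i] the increments form a fresh walk independent of the past. The one-point sum
    bound, applied to it from time [t - S i], raises the second index from [q] to [q.+1]. *)
Lemma walk_pair_le p q t i n :
  (\sum_(k < n) \int[P]_w ((tpow p (t - S i w))%:E * (tpow q (t - S (i + k.+1) w))%:E)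
   <= \int[P]_w ((tpow p (t - S i w))%:E * (tpow q.+1 (t - S i w))%:E))%E.
Proof.
pose D1 : set nat := [set k | (k < i)%N]; pose D2 : set nat := [set k | (i <= k)%N].
pose y k := x (i + k)%N.
have hy : iid_exp P y.
  by apply: (iid_exp_reindex (h := addn i) _ hx) => a b /addnI.
have D0 : D1 `&` D2 = set0.
  by apply/seteqP; split => // k []; rewrite /D1 /D2 /= => ki; rewrite leqNgt ki.
have [_ _ ix] := hx.
pose h k w : \bar R := (\int[P]_w' (tpow q (t - S i w - \sum_(l < k.+1) y l w'))%:E)%E.
have mh k : measurable_fun setT (h k).
  apply: (@measurable_fun_fubini_tonelli_F _ _ _ _ _ P
    (fun w => (tpow q (t - S i w.1 - \sum_(l < k.+1) y l w.2))%:E)).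
    apply/measurable_EFinP; apply: (measurableT_comp (measurable_tpow q)).
    apply: measurable_funB.
      by apply: measurable_funB => //; exact: (measurableT_comp (mS i)).
    apply: measurable_sum => l; exact: (measurableT_comp (mx _)).
  by move=> w; rewrite lee_fin tpow_ge0.
have h0 k w : (0 <= h k w)%E by apply: integral_ge0 => *; rewrite lee_fin tpow_ge0.
have E k : (\int[P]_w ((tpow p (t - S i w))%:E * (tpow q (t - S (i + k.+1) w))%:E) =
    \int[P]_w ((tpow p (t - S i w))%:E * h k w))%E.
  pose F (w : cyl_type x D1 * cyl_type x D2) : \bar R :=
    ((tpow p (t - S i w.1))%:E *
     (tpow q (t - S i w.1 - \sum_(l < k.+1) y l w.2))%:E)%E.
  have mF1 : measurable_fun setT
      (fun w : cyl_type x D1 * cyl_type x D2 => t - S i w.1).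
    apply: measurable_funB => //; apply: measurable_sum => l.
    apply: (measurableT_comp (f := x l : cyl_type x D1 -> R)) => //.
    by apply: measurable_cyl_type; rewrite /D1/=.
  have mF : measurable_fun setT F.
    apply: emeasurable_funM; apply/measurable_EFinP.
      exact: (measurableT_comp (measurable_tpow p)).
    apply: (measurableT_comp (measurable_tpow q)).
    apply: measurable_funB => //; apply: measurable_sum => l.
    apply: (measurableT_comp (f := y l : cyl_type x D2 -> R)) => //.
    by apply: measurable_cyl_type; rewrite /D2/= leq_addr.
  have F0 w : (0 <= F w)%E by rewrite /F mule_ge0// lee_fin tpow_ge0.
  have := ge0_integral_decouple ix mx D0 mF F0; rewrite /F/= => dec.
  under eq_integral do rewrite big_split_ord/= opprD addrA.
  rewrite dec; apply: eq_integral => w _.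
  rewrite ge0_integralZl//; last 3 first.
  - apply/measurable_EFinP; apply: (measurableT_comp (measurable_tpow q)).
    apply: measurable_funB => //; apply: measurable_sum => l; exact: mx.
  - by move=> *; rewrite lee_fin tpow_ge0.
  - by rewrite lee_fin tpow_ge0.
under eq_bigr do rewrite E.
rewrite -ge0_integral_sum//; last 2 first.
- by move=> k; exact: emeasurable_funM.
- by move=> k w _; rewrite mule_ge0// lee_fin tpow_ge0.
apply: ge0_le_integral => //.
- by move=> w _; apply: sume_ge0 => k _; rewrite mule_ge0// lee_fin tpow_ge0.
- by apply: emeasurable_sum => k; exact: emeasurable_funM.
- exact: emeasurable_funM.
move=> w _; rewrite -ge0_sume_distrr//.
by rewrite lee_wpmul2l ?lee_fin ?tpow_ge0//; exact: walk_tpow_sum_le.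
Qed.

(** Serves to show that the diagonal of E B^2, for B the sum of conditional means, is finite and
    hence can be cancelled. *)
Lemma walk_diag_le m t N :
  (\sum_(0 <= i < N) \int[P]_w ((tpow m (t - S i.+1 w))%:E * (tpow m (t - S i.+1 w))%:E)
   <= ('C(m + m, m)%:R * tpow (m + m).+1 t)%:E)%E.
Proof.
under eq_bigr => i _.
  under eq_integral do rewrite -EFinM tpowM EFinM.
  rewrite ge0_integralZl//; [|by move=> *; rewrite lee_fin tpow_ge0].
  over.
rewrite /= -ge0_sume_distrr; last first.
  by move=> i _; apply: integral_ge0 => *; rewrite lee_fin tpow_ge0.
by rewrite EFinM lee_wpmul2l// big_mkord; exact: walk_tpow_sum_le.
Qed.

Lemma walk_off_le m t N :
  (\sum_(0 <= i < N) \sum_(i.+1 <= j < N)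
     \int[P]_w ((tpow m (t - S i.+1 w))%:E * (tpow m (t - S j.+1 w))%:E)
   <= ('C(m + m.+1, m)%:R * tpow (m + m.+1).+1 t)%:E)%E.
Proof.
apply: (@le_trans _ _ (\sum_(0 <= i < N)
    \int[P]_w ((tpow m (t - S i.+1 w))%:E * (tpow m.+1 (t - S i.+1 w))%:E))%E).
  apply: lee_sum => i _; rewrite -{1}[i.+1]add0n big_addn big_mkord.
  apply: le_trans (walk_pair_le m m t i.+1 (N - i.+1)).
  by apply: lee_sum => k _; rewrite [(i.+1 + k.+1)%N]addnS [(i.+1 + k)%N]addnC.
under eq_bigr => i _.
  under eq_integral do rewrite -EFinM tpowM EFinM.
  rewrite ge0_integralZl//; [|by move=> *; rewrite lee_fin tpow_ge0].
  over.
rewrite /= -ge0_sume_distrr; last first.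
  by move=> i _; apply: integral_ge0 => *; rewrite lee_fin tpow_ge0.
by rewrite EFinM lee_wpmul2l// big_mkord; exact: walk_tpow_sum_le.
Qed.

End walk_pairs.

(** * Second moment of a generation and of the centred sum *)

Section second_moments.
Context {d : measure_display} {Omega : measurableType d} {R : realType}.
Variable P : probability Omega R.
Implicit Types xi : seq nat -> Omega -> R.

(* For [n = m.+1] this is E Y_m(t)^2, for [n = m] it is Var Y_m(t). *)
Definition moment_sum (n m : nat) (t : R) : R :=
  \sum_(j < n) 'C(j + j, j)%:R * tpow (m + j) t.

Lemma moment_sum_ge0 n m t : 0 <= moment_sum n m t.
Proof. by apply: sumr_ge0 => j _; rewrite mulr_ge0// tpow_ge0. Qed.

Lemma measurable_moment_sum n m : measurable_fun setT (moment_sum n m).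
Proof.
apply: measurable_sum => j; apply: measurable_funM => //; exact: measurable_tpow.
Qed.

Lemma moment_sumS m t : moment_sum m.+1 m t = moment_sum m m t + tpow m t * tpow m t.
Proof. by rewrite /moment_sum big_ord_recr/= tpowM. Qed.

Lemma walk_moment_sum_le (x : nat -> Omega -> R) n m t N : iid_exp P x ->
  (\sum_(0 <= i < N) \int[P]_w (moment_sum n m (t - \sum_(k < i.+1) x k w))%:E
   <= (moment_sum n m.+1 t)%:E)%E.
Proof.
move=> hx; have [mx _ _] := hx.
have mt p i : measurable_fun setT (fun w => (tpow p (t - \sum_(k < i) x k w))%:E).
  apply/measurable_EFinP; apply: (measurableT_comp (measurable_tpow p)).
  by apply: measurable_funB => //; exact: measurable_sum.
under eq_bigr => i _.
  under eq_integral do rewrite /moment_sum -sumEFin.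
  rewrite ge0_integral_sum//; last 2 first.
  - move=> j; under eq_fun do rewrite EFinM; exact: emeasurable_funM.
  - by move=> *; rewrite lee_fin mulr_ge0// tpow_ge0.
  under eq_bigr do under eq_integral do rewrite EFinM.
  under eq_bigr => j _.
    rewrite ge0_integralZl//; [|by move=> *; rewrite lee_fin tpow_ge0]; over.
  over.
rewrite /= exchange_big/= /moment_sum -sumEFin; apply: lee_sum => j _.
rewrite -ge0_sume_distrr; last first.
  by move=> i _; apply: integral_ge0 => *; rewrite lee_fin tpow_ge0.
by rewrite EFinM lee_wpmul2l// big_mkord addSn; exact: walk_tpow_sum_le.
Qed.

(** By Pascal's rule and symmetry C(2m+2, m+1) is twice C(2m+1, m), so the two off-diagonal bounds
    supply exactly the new top term. *)
Lemma moment_sum_rec m t :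
  moment_sum m.+1 m.+1 t + ('C(m + m.+1, m)%:R * tpow (m + m.+1).+1 t +
                            'C(m + m.+1, m)%:R * tpow (m + m.+1).+1 t)
  = moment_sum m.+2 m.+1 t.
Proof.
rewrite [in RHS]/moment_sum [in RHS]big_ord_recr/=; congr (_ + _).
rewrite -mulrDl addSn; congr (_ * _); rewrite -natrD; congr (_%:R).
rewrite binS; congr (_ + _)%N; rewrite -[in RHS]bin_sub ?leq_addl//.
by rewrite addnK.
Qed.

(** The bound on E Y_m^2 is assumed here because this lemma is also used inside the induction that
    proves it. *)
Lemma integral_branch_sqr_le xi m t i : iid_exp P xi ->
  (forall s xi', iid_exp P xi' ->
    \int[P]_w (Ygen (xi'^~ w) m s * Ygen (xi'^~ w) m s) <= (moment_sum m.+1 m s)%:E)%E ->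
  (\int[P]_w (branch xi m t i w w * branch xi m t i w w) <=
   \int[P]_w (moment_sum m.+1 m (t - Swalk (xi^~ w) i.+1))%:E)%E.
Proof.
move=> hxi IH; have [mxi _ _] := hxi.
rewrite (decouple_walk (xi := xi)
  (F := fun w1 w2 => branch xi m t i w1 w2 * branch xi m t i w1 w2)%E)//;
  last 2 first.
- by apply: emeasurable_funM; exact: measurable_branch_sub.
- by move=> *; apply: mule_ge0; exact: branch_ge0.
have mb : measurable_fun setT (fun w : Omega * Omega => branch xi m t i w.1 w.2).
  apply: (@measurable_Ygen R _ Omega _ _ (fun v => xi (i :: v))) => //.
  apply: measurable_funB => //.
  apply: (measurableT_comp (f := fun w => Swalk (xi^~ w) i.+1)) => //.
  exact: measurable_Swalk.
apply: ge0_le_integral => //.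
- by move=> w _; apply: integral_ge0 => *; rewrite mule_ge0// branch_ge0.
- apply: (@measurable_fun_fubini_tonelli_F _ _ _ _ _ P
    (fun w => branch xi m t i w.1 w.2 * branch xi m t i w.1 w.2)%E).
    exact: emeasurable_funM.
  by move=> w; rewrite mule_ge0// branch_ge0.
- apply/measurable_EFinP; apply: (measurableT_comp (measurable_moment_sum _ _)).
  by apply: measurable_funB => //; exact: measurable_Swalk.
move=> w _; exact: (IH _ (fun v => xi (i :: v)) (iid_exp_subtree i hxi)).
Qed.

Lemma integral_partial_sqr xi m t N : iid_exp P xi ->
  (\int[P]_w ((\sum_(0 <= i < N) branch xi m t i w w) *
              (\sum_(0 <= i < N) branch xi m t i w w)) =
   \sum_(0 <= i < N) \int[P]_w (branch xi m t i w w * branch xi m t i w w) +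
   (\sum_(0 <= i < N) \sum_(i.+1 <= j < N)
     \int[P]_w ((tpow m (t - Swalk (xi^~ w) i.+1))%:E * (tpow m (t - Swalk (xi^~ w) j.+1))%:E) +
    \sum_(0 <= i < N) \sum_(i.+1 <= j < N)
     \int[P]_w ((tpow m (t - Swalk (xi^~ w) i.+1))%:E * (tpow m (t - Swalk (xi^~ w) j.+1))%:E)))%E.
Proof.
move=> hxi; have [mxi _ _] := hxi.
rewrite integral_sumM; last 4 first.
- by move=> i; exact: measurable_branch.
- by move=> i; exact: measurable_branch.
- by move=> *; exact: branch_ge0.
- by move=> *; exact: branch_ge0.
rewrite sum_triangle; last by move=> i j; under eq_integral do rewrite muleC.
suff -> : (\sum_(0 <= i < N) \sum_(i.+1 <= j < N)
     \int[P]_w (branch xi m t i w w * branch xi m t j w w) =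
   \sum_(0 <= i < N) \sum_(i.+1 <= j < N)
     \int[P]_w ((tpow m (t - Swalk (xi^~ w) i.+1))%:E * (tpow m (t - Swalk (xi^~ w) j.+1))%:E))%E by [].
apply: eq_bigr => i _; apply: eq_big_nat => j /andP[ij _].
by apply: integral_branch2 => //; rewrite ltn_eqF.
Qed.

Lemma integral_Ygen_sqr_le m t xi : iid_exp P xi ->
  (\int[P]_w (Ygen (xi^~ w) m t * Ygen (xi^~ w) m t) <= (moment_sum m.+1 m t)%:E)%E.
Proof.
elim: m t xi => [|m IHm] t xi hxi.
  under eq_integral do rewrite Ygen0 -EFinM tpowM.
  by rewrite integral_prob_cst lee_fin /moment_sum big_ord1.
have [mxi _ _] := hxi.
pose A N w := (\sum_(0 <= i < N) branch xi m t i w w)%E.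
have mA N : measurable_fun setT (A N).
  by apply: emeasurable_sum => i; exact: measurable_branch.
have A0 N w : (0 <= A N w)%E by apply: sume_ge0 => *; exact: branch_ge0.
have ndA w : {homo A^~ w : n k / (n <= k)%N >-> (n <= k)%E}.
  by move=> n k nk; apply: lee_sum_nneg_natr => // *; exact: branch_ge0.
have Acvg w : (A N w @[N --> \oo] --> Ygen (xi^~ w) m.+1 t)%E.
  by rewrite YgenS; apply: is_cvg_nneseries => *; exact: branch_ge0.
have A2cvg w : (limn (fun N => A N w * A N w) = Ygen (xi^~ w) m.+1 t * Ygen (xi^~ w) m.+1 t)%E.
  (* The two factors have the same limit, which excludes the indeterminate product of 0 and
     [+oo]. *)
  apply/cvg_lim => //; apply: cvgeM => //.
  by rewrite /mule_def; case: (Ygen _ _ _) => [r| |] //=; rewrite !andbF.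
under eq_integral do rewrite -A2cvg.
rewrite (monotone_convergence P measurableT (g' := fun N w => (A N w * A N w)%E)); last 3 first.
- by move=> N; exact: emeasurable_funM.
- by move=> N w _; exact: mule_ge0.
- by move=> w _ n k nk; apply: lee_pmul => //; exact: ndA.
apply: lime_le.
  apply: ereal_nondecreasing_is_cvgn => n k nk; apply: ge0_le_integral => //.
  - by move=> w _; exact: mule_ge0.
  - exact: emeasurable_funM.
  - exact: emeasurable_funM.
  - by move=> w _; apply: lee_pmul => //; exact: ndA.
apply: nearW => N; rewrite integral_partial_sqr// -moment_sum_rec !EFinD.
apply: leeD; last by apply: leeD; exact: (walk_off_le (iid_exp_walk hxi)).
apply: le_trans (walk_moment_sum_le m.+1 m t N (iid_exp_walk hxi)).
by apply: lee_sum => i _; exact: integral_branch_sqr_le.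
Qed.

(** With A the sum of the branches and B the sum of their conditional means, E AB = E B^2, so E (A -
    B)^2 is E A^2 - E B^2. The off-diagonal parts of the two agree, and only variances remain. *)
Lemma integral_centered_sqr_le m t N xi : iid_exp P xi ->
  (\int[P]_w ((\sum_(0 <= i < N) branch xi m t i w w -
               (\sum_(0 <= i < N) tpow m (t - Swalk (xi^~ w) i.+1))%:E) *
              (\sum_(0 <= i < N) branch xi m t i w w -
               (\sum_(0 <= i < N) tpow m (t - Swalk (xi^~ w) i.+1))%:E))
   <= (moment_sum m m.+1 t)%:E)%E.
Proof.
move=> hxi; have [mxi _ _] := hxi.
pose A w := (\sum_(0 <= i < N) branch xi m t i w w)%E.
pose b i w := (tpow m (t - Swalk (xi^~ w) i.+1))%:E.
pose B w := \sum_(0 <= i < N) tpow m (t - Swalk (xi^~ w) i.+1).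
have mb i : measurable_fun setT (b i) by exact: measurable_tpow_walk.
have b0 i w : (0 <= b i w)%E by rewrite lee_fin tpow_ge0.
have BE w : ((B w)%:E = \sum_(0 <= i < N) b i w)%E by rewrite /B -sumEFin.
have mA : measurable_fun setT A.
  by apply: emeasurable_sum => i; exact: measurable_branch.
have mB : measurable_fun setT (fun w => (B w)%:E).
  by under eq_fun do rewrite BE; exact: emeasurable_sum.
have A0 w : (0 <= A w)%E by apply: sume_ge0 => *; exact: branch_ge0.
have B0 w : (0 <= (B w)%:E)%E by rewrite BE sume_ge0.
pose D := (\sum_(0 <= i < N) \int[P]_w (b i w * b i w))%E.
pose O := (\sum_(0 <= i < N) \sum_(i.+1 <= j < N) \int[P]_w (b i w * b j w))%E.
have BB : (\int[P]_w ((B w)%:E * (B w)%:E) = D + (O + O))%E.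
  under eq_integral do rewrite BE.
  rewrite integral_sumM// sum_triangle//.
  by move=> i j; under eq_integral do rewrite muleC.
have AB : (\int[P]_w (A w * (B w)%:E) = D + (O + O))%E.
  under eq_integral do rewrite BE.
  rewrite /A integral_sumM//; last 2 first.
  - by move=> i; exact: measurable_branch.
  - by move=> *; exact: branch_ge0.
  rewrite -BB; under [in RHS]eq_integral do rewrite BE.
  rewrite integral_sumM//.
  by apply: eq_bigr => i _; apply: eq_bigr => j _; exact: integral_branch_walk.
have bs0 i : (0 <= \int[P]_w (b i w * b i w))%E.
  by apply: integral_ge0 => w _; exact: mule_ge0.
have mm i : measurable_fun setT (fun w => (moment_sum m m (t - Swalk (xi^~ w) i.+1))%:E).
  apply/measurable_EFinP; apply: (measurableT_comp (measurable_moment_sum _ _)).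
  by apply: measurable_funB => //; exact: measurable_Swalk.
have AA : (\int[P]_w (A w * A w) <= (moment_sum m m.+1 t)%:E + (D + (O + O)))%E.
  rewrite /A integral_partial_sqr// [X in (_ <= X)%E]addeA; apply: leeD => //.
  apply: (@le_trans _ _ (\sum_(0 <= i < N)
      (\int[P]_w (moment_sum m m (t - Swalk (xi^~ w) i.+1))%:E +
       \int[P]_w (b i w * b i w)))%E).
    apply: lee_sum => i _; apply: le_trans (integral_branch_sqr_le _ _ hxi _) _.
      by move=> s xi' hxi'; exact: integral_Ygen_sqr_le.
    (* The top term of the bound on E Y_m^2 is f_m^2; along the walk it sums to the diagonal [D] of
       E B^2. *)
    under eq_integral do rewrite moment_sumS EFinD EFinM.
    rewrite ge0_integralD//.
    - by move=> *; rewrite lee_fin moment_sum_ge0.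
    - by move=> w _; exact: (mule_ge0 (b0 i w) (b0 i w)).
    - exact: (emeasurable_funM (mb i) (mb i)).
  rewrite big_split/=; apply: leeD => //.
  exact: (walk_moment_sum_le m m t N (iid_exp_walk hxi)).
have O0 : (0 <= O)%E.
  by apply: sume_ge0 => i _; apply: sume_ge0 => j _; apply: integral_ge0 => w _; exact: mule_ge0.
have D0 : (0 <= D)%E by apply: sume_ge0.
have Ofin : O \is a fin_num.
  rewrite ge0_fin_numE//; apply: le_lt_trans (ltry _).
  exact: (walk_off_le (iid_exp_walk hxi) m t N).
have Dfin : D \is a fin_num.
  rewrite ge0_fin_numE//; apply: le_lt_trans (ltry _).
  exact: (walk_diag_le (iid_exp_walk hxi) m t N).
have DOfin : (D + (O + O))%E \is a fin_num by rewrite !fin_numD Dfin Ofin.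
have C0 w : (0 <= (A w - (B w)%:E) * (A w - (B w)%:E))%E.
  case: (A w) (A0 w) => [a| |]//= _; first by rewrite -EFinB -EFinM lee_fin -expr2 sqr_ge0.
have mC : measurable_fun setT (fun w => (A w - (B w)%:E) * (A w - (B w)%:E))%E.
  by apply: emeasurable_funM; exact: emeasurable_funB.
have mAB : measurable_fun setT (fun w => A w * (B w)%:E)%E by exact: emeasurable_funM.
have AB0 w : (0 <= A w * (B w)%:E)%E by exact: mule_ge0.
have : (\int[P]_w ((A w - (B w)%:E) * (A w - (B w)%:E)) +
    (\int[P]_w (A w * (B w)%:E) + \int[P]_w (A w * (B w)%:E)) =
    \int[P]_w (A w * A w) + \int[P]_w ((B w)%:E * (B w)%:E))%E.
  rewrite -!ge0_integralD//; try by (move=> *; rewrite ?adde_ge0 ?mule_ge0).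
  - by apply: eq_integral => w _; apply: sqr_sub_add; [exact: A0|rewrite -lee_fin; exact: B0].
  - exact: emeasurable_funM.
  - exact: emeasurable_funM.
  - exact: emeasurable_funD.
rewrite AB BB => H.
(* The finite cross term is added to both sides, in place of a subtraction. *)
rewrite -(@leeD2rE _ ((D + (O + O)) + (D + (O + O)))%E); last by rewrite fin_numD DOfin.
by rewrite H [X in (_ <= X)%E]addeA; exact: leeD2r.
Qed.

End second_moments.

(** * Asymptotics and convergence *)

Section asymptotics.
Context {R : realType}.
Implicit Types t : R.

Lemma central_bin_double j : ('C(j + j, j).*2 <= 'C(j.+1 + j.+1, j.+1))%N.
Proof.
have -> : 'C(j.+1 + j.+1, j.+1) = 'C(j + j.+1, j).*2.
  rewrite addSn binS -addnn -[X in (X + _)%N]bin_sub ?leq_addl//.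
  by rewrite addnK.
by rewrite leq_double leq_bin2l// leq_add2l.
Qed.

Lemma tpow_succ p t : 0 < t -> tpow p t = p.+1%:R / t * tpow p.+1 t.
Proof.
move=> t0; rewrite /tpow (ltW t0) factS natrM exprS.
have h1 : (p`!%:R : R) != 0 by rewrite pnatr_eq0 -lt0n fact_gt0.
have h2 : (p.+1%:R : R) != 0 by rewrite pnatr_eq0.
move: (p.+1%:R : R) h2 (p`!%:R : R) h1 => a a0 b b0.
by field; rewrite a0 b0 (gt_eqF t0).
Qed.

(* Consecutive terms of the sum grow at least by the factor [t / m.+1 >= 2]. *)
Lemma moment_sum_le m t : 0 < t -> 2 * m.+1%:R <= t ->
  moment_sum m m.+1 t <= 2 * (m.+1%:R / t) * ('C(m + m, m)%:R * tpow (m + m).+1 t).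
Proof.
move=> t0 mt; set q := _ / t.
have q0 : 0 <= q by rewrite divr_ge0// ltW.
have q1 : 2 * q <= 1 by rewrite /q mulrA ler_pdivrMr// mul1r.
pose a j : R := 'C(j + j, j)%:R * tpow (m.+1 + j) t.
have a0 j : 0 <= a j by rewrite mulr_ge0// tpow_ge0.
(* Lowering the index of [tpow] costs (m+j+2)/t, at most 2(m+1)/t; the doubling of the central
   binomial absorbs the factor 2. *)
have step j : (j < m)%N -> a j <= q * a j.+1.
  move=> jm; rewrite /a tpow_succ// [(m.+1 + j.+1)%N]addnS.
  set T := tpow _ t; have T0 : 0 <= T by exact: tpow_ge0.
  have c1 : ('C(j + j, j)%:R *+ 2 : R) <= 'C(j.+1 + j.+1, j.+1)%:R.
    by rewrite -mulrnA muln2 ler_nat central_bin_double.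
  have c2 : ((m.+1 + j).+1%:R : R) <= m.+1%:R *+ 2.
    by rewrite -mulrnA ler_nat; lia.
  rewrite /q [X in _ <= X](_ : _ = m.+1%:R * 'C(j.+1 + j.+1, j.+1)%:R * (T / t)); last by ring.
  rewrite [X in X <= _](_ : _ = (m.+1 + j).+1%:R * 'C(j + j, j)%:R * (T / t)); last by ring.
  rewrite ler_wpM2r ?divr_ge0 ?(ltW t0)//.
  apply: (@le_trans _ _ (m.+1%:R *+ 2 * 'C(j + j, j)%:R)); first by rewrite ler_wpM2r.
  by rewrite mulrnAl -mulrnAr ler_wpM2l.
(* Induction: 2q a_l + a_l <= 2 a_l because 2q <= 1, and a_l <= q a_{l+1}. *)
have sum l : (l <= m)%N -> \sum_(j < l) a j <= 2 * q * a l.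
  elim: l => [|l IHl] lm; first by rewrite big_ord0 mulr_ge0// mulr_ge0.
  rewrite big_ord_recr/=; apply: (@le_trans _ _ (2 * a l)).
    rewrite mulr_natl mulr2n lerD2r; apply: le_trans (IHl (ltnW lm)) _.
    by rewrite -[X in _ <= X]mul1r ler_wpM2r.
  by rewrite -mulrA ler_wpM2l// step.
exact: (sum m).
Qed.

(** Since (2m+1)! = (2m+1) C(2m, m) m!^2, factorials and binomial cancel and leave
    (2/t)(m+1)/(2m+1), bounded uniformly in [m]. *)
Lemma scaled_moment_sum_le m t : 0 < t -> 2 * m.+1%:R <= t ->
  m`!%:R ^+ 2 / t ^+ (m + m).+1 * moment_sum m m.+1 t <= 2 / t.
Proof.
move=> t0 mt; have tn0 : t != 0 by rewrite gt_eqF.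
have f0 n : (n`!%:R : R) != 0 by rewrite pnatr_eq0 -lt0n fact_gt0.
have h2 : ((m + m).+1%:R : R) != 0 by rewrite pnatr_eq0.
have c0 : 0 <= m`!%:R ^+ 2 / t ^+ (m + m).+1 by rewrite divr_ge0// exprn_ge0// ltW.
apply: le_trans (ler_wpM2l c0 (moment_sum_le t0 mt)) _.
have fE : ((m + m).+1`!%:R : R) = (m + m).+1%:R * 'C(m + m, m)%:R * m`!%:R ^+ 2.
  by rewrite factS -(bin_fact (leq_addr m m)) addnK !natrM expr2; ring.
have b0 : ('C(m + m, m)%:R : R) != 0.
  by rewrite pnatr_eq0 -lt0n bin_gt0 leq_addr.
rewrite /tpow (ltW t0) fE.
have tp0 : t ^+ (m + m).+1 != 0 by rewrite expf_neq0.
rewrite [X in X <= _](_ : _ = 2 / t * (m.+1%:R / (m + m).+1%:R)).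
  rewrite ler_piMr ?divr_ge0 ?(ltW t0)// ler_pdivrMr ?mul1r ?ltr0n//.
  by rewrite ler_nat; lia.
move: (t ^+ _) tp0 ('C(m + m, m)%:R : R) b0 (m`!%:R : R) (f0 m) (m.+1%:R : R)
  ((m + m).+1%:R : R) h2 => T T0 b b0' c c0' e g g0.
by field; rewrite tn0 T0 b0' c0' g0.
Qed.

(** With M = m + 1, the exponent M - 1/2 doubles to the integer 2m + 1. *)
Lemma sqr_coef (kt m : nat) t : 0 < t ->
  (Num.sqrt kt%:R * m`!%:R / powR t (m.+1%:R - 2^-1)) ^+ 2 =
  kt%:R * (m`!%:R ^+ 2 / t ^+ (m + m).+1) :> R.
Proof.
move=> t0; rewrite expr_div_n exprMn sqr_sqrtr//.
rewrite -[X in _ / X = _]powR_mulrn ?powR_ge0// -powRrM.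
rewrite (_ : _ * 2%:R = (m + m).+1%:R); first by rewrite powR_mulrn ?(ltW t0)// mulrA.
by rewrite -[m.+1]addn1 -[(m + m).+1]addn1 !natrD; field.
Qed.

End asymptotics.

(** * Integral comparison and bounds on exceptional events *)

Section integral_bounds.
Context {d : measure_display} {Omega : measurableType d} {R : realType}.
Variable P : probability Omega R.
Import HBNNSimple.

Lemma markov_ge0 (f : Omega -> \bar R) (a : R) : measurable_fun setT f ->
  (forall w, 0 <= f w)%E -> 0 < a ->
  (a%:E * P [set w | a%:E <= f w] <= \int[P]_w f w)%E.
Proof.
move=> mf f0 a0.
have := @le_integral_comp_abse _ _ _ P setT measurableT f a id (@measurable_id _ _ setT)
  (fun r r0 => r0) (fun x y _ _ xy => xy) mf a0.
rewrite setTI; congr (_ * P _ <= _)%E.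
  by apply/seteqP; split => w /=; rewrite gee0_abs.
by apply: eq_integral => w _; rewrite gee0_abs.
Qed.

(* The integrands need not be measurable: nothing is known about the [limn] in
   [Xproc], and the integral of a non-negative function is defined as the supremum
   of the integrals of the simple functions below it. *)
Lemma le_integral_pointwise (f g : Omega -> R) : (forall w, f w <= g w) ->
  (\int[P]_w (f w)%:E <= \int[P]_w (g w)%:E)%E.
Proof.
move=> fg; rewrite integralE [X in (_ <= X)%E]integralE; apply: leeB.
  rewrite !ge0_integralTE//; apply: le_ereal_sup => _ [h hf <-].
  exists h => // w; apply: le_trans (hf w) _.
  by rewrite !funeposE ge_max !le_max lee_fin fg lexx orbT.
rewrite !ge0_integralTE//; apply: le_ereal_sup => _ [h hf <-].
exists h => // w; apply: le_trans (hf w) _.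
by rewrite !funenegE ge_max !le_max leeN2 lee_fin fg lexx orbT.
Qed.

(** [g] lies between c - e - 2K 1_E and c + e + 2K 1_E. These are integrable, so monotonicity alone
    makes the integral of [g] finite and close to [c]. *)
Lemma integral_near_cst (g : Omega -> R) (E : set Omega) (c K e p : R) :
  measurable E -> (forall w, `|g w| <= K) -> `|c| <= K -> 
  (forall w, ~ E w -> `|g w - c| <= e) -> 0 <= e -> (P E <= p%:E)%E ->
  exists2 I : R, (\int[P]_w (g w)%:E = I%:E)%E & `|I - c| <= e + 2 * K * p.
Proof.
move=> mE gK cK gc e0 PE.
have K0 : 0 <= K by apply: le_trans cK.
have int_affine (a b : R) : (\int[P]_w (a + b * \1_E w)%:E = a%:E + b%:E * P E)%E.
  under eq_integral do rewrite EFinD EFinM.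
  rewrite integralD//.
  - rewrite integral_prob_cst integralZl//; last exact: integrable_indic.
    by rewrite integral_indic// setIT.
  - exact: finite_measure_integrable_cst.
  - by apply: integrableZl => //; exact: integrable_indic.
have up w : g w <= (c + e) + 2 * K * \1_E w.
  rewrite indicE; case: (boolP (w \in E)) => wE.
    have := gK w; rewrite ler_norml => /andP[_ h1].
    have := cK; rewrite ler_norml => /andP[h2 _]; rewrite /=; lra.
  have /gc : ~ E w by move/mem_set; exact/negP.
  rewrite ler_norml => /andP[_]; rewrite /=; lra.
have lo w : (c - e) + - (2 * K) * \1_E w <= g w.
  rewrite indicE; case: (boolP (w \in E)) => wE.
    have := gK w; rewrite ler_norml => /andP[h1 _].
    have := cK; rewrite ler_norml => /andP[_ h2]; rewrite /=; lra.
  have /gc : ~ E w by move/mem_set; exact/negP.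
  rewrite ler_norml => /andP[h _]; move: h; rewrite /=; lra.
have [pE pEE] : exists pE, P E = pE%:E.
  by exists (fine (P E)); rewrite fineK// fin_num_measure.
move: PE; rewrite pEE lee_fin => PE.
have := le_integral_pointwise up; have := le_integral_pointwise lo.
rewrite !int_affine pEE -!EFinM -!EFinD.
case: (integral P setT _) => [I| |]//=; rewrite ?leNye ?leye_eq// !lee_fin => h1 h2.
exists I => //; rewrite ler_norml.
have : 2 * K * pE <= 2 * K * p by rewrite ler_wpM2l// mulr_ge0.
by move: h1 h2; rewrite !mulNr => *; apply/andP; split; lra.
Qed.

Lemma measure_bigsetU_le {I : Type} (s : seq I) (A : I -> set Omega) :
  (forall i, measurable (A i)) ->
  (P (\big[setU/set0]_(i <- s) A i) <= \sum_(i <- s) P (A i))%E.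
Proof.
move=> mA; elim: s => [|i s IH]; first by rewrite !big_nil measure0.
rewrite !big_cons.
apply: (@le_trans _ _ (P (A i) + P (\big[setU/set0]_(j <- s) A j))%E); last exact: leeD2l.
by apply: measureU2 => //; exact: bigsetU_measurable.
Qed.

End integral_bounds.

Lemma Swalk_homo {R : realType} (xi : seq nat -> R) n n' :
  (forall v, 0 <= xi v) -> (n <= n')%N -> Swalk xi n <= Swalk xi n'.
Proof.
move=> xi0 /subnKC <-; rewrite /Swalk big_split_ord/= lerDl.
by apply: sumr_ge0 => k _.
Qed.

(** The walk is nondecreasing on this path, so the terms from [N] on vanish and the limit is that of
    an eventually constant sequence. *)
Lemma Xproc_partial {R : realType} (k : R -> R) (xi : seq nat -> R) t u N m :
  (forall v, 0 <= xi v) -> t < Swalk xi N -> Num.truncn (k t * u) = m.+1 ->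
  Xproc k xi t u =
  Num.sqrt (Num.truncn (k t))%:R * m`!%:R / powR t (m.+1%:R - 2^-1) *
  \sum_(0 <= i < N) (fine (Ygen (subtree xi i) m (t - Swalk xi i.+1))
                     - tpow m (t - Swalk xi i.+1)).
Proof.
move=> xi0 tN Mm; rewrite /Xproc Mm/=; congr (_ * _).
apply: lim_near_cst => //; near=> n.
have Nn : (N <= n)%N by near: n; exact: nbhs_infty_ge.
rewrite (big_cat_nat (leq0n N) Nn)//= [X in _ + X]big_nat_cond [X in _ + X]big1 ?addr0.
  apply: eq_bigr => i _; case: ifPn => st.
    by rewrite mulr1 /Ysub /Um/= /tpow subr_ge0 st.
  (* For a child born after [t] both the count and the truncated mean are 0, which lets the
     indicator be dropped. *)
  rewrite mulr0 Ygen_lt0 ?subr_lt0 ?ltNge//; last by move=> v; exact: xi0.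
  by rewrite /tpow subr_ge0 (negbTE st) subrr.
move=> i /andP[/andP[Ni _] _]; rewrite ifF ?mulr0//; apply/negbTE; rewrite -ltNge.
by apply: lt_le_trans tN _; apply: Swalk_homo => //; exact: leqW.
Unshelve. all: by end_near.
Qed.

(** * Paths on which the normalised sum is small *)

Section smallness.
Context {d : measure_display} {Omega : measurableType d} {R : realType}.
Variable P : probability Omega R.
Variable xi : seq nat -> Omega -> R.
Hypothesis hxi : iid_exp P xi.

Let mxi v : measurable_fun setT (xi v). Proof. by case: hxi. Qed.

Let centered m t N w : \bar R :=
  (\sum_(0 <= i < N) branch xi m t i w w -
    (\sum_(0 <= i < N) tpow m (t - Swalk (xi^~ w) i.+1))%:E)%E.

Definition large_dev m t N (a : R) : set Omega :=
  [set w | (a%:E <= centered m t N w * centered m t N w)%E].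

Let measurable_centered m t N : measurable_fun setT (centered m t N).
Proof.
apply: emeasurable_funB.
  by apply: emeasurable_sum => i; exact: measurable_branch.
under eq_fun do rewrite -sumEFin.
by apply: emeasurable_sum => i; exact: measurable_tpow_walk.
Qed.

Lemma measurable_large_dev m t N a : measurable (large_dev m t N a).
Proof.
rewrite /large_dev -[X in measurable X]setTI; apply: emeasurable_fun_c_infty => //.
by apply: emeasurable_funM.
Qed.

Lemma prob_large_dev m t N a : 0 < a ->
  (P (large_dev m t N a) <= (moment_sum m m.+1 t / a)%:E)%E.
Proof.
move=> a0; rewrite EFinM muleC -(@lee_pmul2l _ a%:E)// ?lte_fin//.
rewrite -!EFinM mulrA divff ?gt_eqF// mul1r.
apply: le_trans (integral_centered_sqr_le m t N hxi).
apply: markov_ge0 => //; first by apply: emeasurable_funM.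
move=> w; rewrite -/(centered m t N w).
have : centered m t N w != -oo%E.
  rewrite /centered; have : (0 <= \sum_(0 <= i < N) branch xi m t i w w)%E.
    by apply: sume_ge0 => *; exact: branch_ge0.
  by case: (\sum_(0 <= i < N) _)%E.
by case: (centered _ _ _ _) => [x| |]//= _; rewrite -EFinM lee_fin -expr2 sqr_ge0.
Qed.

Lemma small_Xproc (k : R -> R) t u N m r w :
  (forall v, 0 <= xi v w) -> t < Swalk (xi^~ w) N ->
  Num.truncn (k t * u) = m.+1 -> 0 < t -> 0 < r -> 1 <= k t ->
  ~ large_dev m t N (r ^+ 2 / ((Num.truncn (k t))%:R *
      (m`!%:R ^+ 2 / t ^+ (m + m).+1))) w ->
  `|Xproc k (xi^~ w) t u| < r.
Proof.
move=> xi0 tN Mm t0 r0 k1.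
have kt0 : 0 < (Num.truncn (k t))%:R :> R by rewrite ltr0n truncn_gt0.
set c2 := (X in r ^+ 2 / X); have c20 : 0 < c2.
  by rewrite mulr_gt0// divr_gt0 ?exprn_gt0// ltr0n fact_gt0.
rewrite (Xproc_partial xi0 tN Mm) /large_dev /= => /negP; rewrite -ltNge => H.
set c := (_ / _); set T := (\sum_(_ <= _ < _) _).
have cc : c ^+ 2 = c2 by rewrite /c sqr_coef.
(* [fine] would send an infinite count to 0. Infinite counts are ruled out because the centred
   square lies below a real number. *)
have fin i : (i < N)%N -> branch xi m t i w w \is a fin_num.
  move=> iN; have : (\sum_(0 <= i < N) branch xi m t i w w)%E \is a fin_num.
    have sqr_fin (A : \bar R) (b e : R) :
        (0 <= A -> (A - b%:E) * (A - b%:E) < e%:E -> A \is a fin_num)%E.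
      by case: A.
    by apply: sqr_fin H; apply: sume_ge0 => *; exact: branch_ge0.
  by move/sum_fin_numP; apply => //; rewrite mem_index_iota.
have cT : centered m t N w = T%:E.
  rewrite /centered /T sumrB EFinB; congr (_ - _)%E.
  rewrite -sumEFin; apply: eq_big_nat => i /andP[_ iN].
  by rewrite -[LHS](fineK (fin i iN)).
move: H; rewrite cT -EFinM lte_fin -expr2 ltr_pdivlMr// -cc mulrC -exprMn => H.
by rewrite -(ltr_pXn2r (n := 2))// ?nnegrE ?(ltW r0)// real_normK ?num_real.
Qed.

(** [N] depends on [t], which is harmless as the moment bounds are uniform in [N]. *)
Lemma walk_tail t e : 0 < e ->
  exists N, (P [set w | (Swalk (xi^~ w) N <= t)%R] <= e%:E)%E.
Proof.
move=> e0; have := walk_tail_cvg (iid_exp_walk hxi) t.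
move=> /fine_cvgP[_ /cvgrPdist_le /(_ e e0) [N _ /(_ N (leqnn N))]].
rewrite /= sub0r normrN => H; exists N.
rewrite -[X in (X <= _)%E]fineK; last first.
  apply: fin_num_measure; rewrite -[X in measurable X]setTI.
  by apply: measurable_fun_le => //; exact: measurable_Swalk.
by rewrite lee_fin; apply: le_trans (ler_norm _) H.
Qed.

(** Enumerating the labels by [unpickle] makes this a countable union of null events. *)
Definition negative_increment : set Omega := \bigcup_j
  [set w | if unpickle j is Some v then xi v w < 0 else false].

Let negE v : [set w | xi v w < 0] = xi v @^-1` `]-oo, 0[.
Proof. by apply/seteqP; split => w /=; rewrite in_itv/=. Qed.

Lemma measurable_negative_increment : measurable negative_increment.
Proof.
apply: bigcupT_measurable => j; case: (unpickle j) => [v|]; last first.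
  by rewrite [X in measurable X](_ : _ = set0)//; apply/seteqP; split.
by rewrite negE -[X in measurable X]setTI; exact: mxi.
Qed.

Lemma prob_negative_increment : P negative_increment = 0%E.
Proof.
apply: measure_negligible; first exact: measurable_negative_increment.
apply: negligible_bigcup => j; case: (unpickle j) => [v|]; last first.
  rewrite [X in P.-negligible X](_ : _ = set0); first exact: negligible_set0.
  by apply/seteqP; split.
have [_ ex _] := hxi.
rewrite negE; apply/negligibleP.
  by rewrite -[X in measurable X]setTI; exact: mxi.
apply: etrans (ex v `]-oo, 0[%classic (measurable_itv _)) _.
rewrite /exponential_prob integral0_eq// => x /=.
by rewrite in_itv/= => x0; rewrite lt0_exponential_pdf.
Qed.

End smallness.

(** * Convergence of the finite-dimensional distributions *)

Theorem theorem2p1 (R : realType) (k : R -> R)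
  (k_pos : forall t, 0 < k t)
  (k_infty : k t @[t --> +oo] --> +oo)
  (k_small : (fun t => k t / t) @ +oo --> 0)
  (d : measure_display) (Omega : measurableType d) (P : probability Omega R)
  (xi : seq nat -> Omega -> R)
  (xi_meas : forall v, measurable_fun setT (xi v))
  (xi_exp : forall v (A : set R), measurable A ->
     P (xi v @^-1` A) = exponential_prob 1 A)
  (xi_indep : mutually_independent P xi) :
  forall (n : nat) (u : 'I_n -> R), (forall i, 0 < u i) ->
    cvg_dist_const P
      (fun t w => \row_(i < n) Xproc k (fun v => xi v w) t (u i)) 0.
Proof.
have hxi : iid_exp P xi by split.
move=> n u u0 f cf [K fK].
have K0 : 0 <= K by apply: le_trans (fK 0).
suff key (e : R) : 0 < e -> \forall t \near +oo, exists2 I : R,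
    (\int[P]_w (f (\row_(i < n) Xproc k (fun v => xi v w) t (u i)))%:E = I%:E)%E &
    `|I - f 0| <= e.
  apply/fine_cvgP; split.
    by apply: filterS (key 1 ltr01) => t [I ->].
  apply/cvgrPdist_le => e /key; apply: filterS => t [I IE].
  by rewrite /= IE distrC.
move=> e0.
have [r r0 fr] : exists2 r : R, 0 < r & forall x : 'rV[R]_n,
    (forall i, `|x 0 i| < r) -> `|f x - f 0| <= e / 2.
  have /cvgrPdist_le /(_ (e / 2) (divr_gt0 e0 (ltr0n _ 2))) := cf 0.
  move=> /nbhs_ballP[r r0 H]; exists r => // x xr.
  rewrite distrC; apply: H; split => // i j; rewrite mxE /ball/= sub0r normrN ord1.
  exact: xr.
(* Chosen so that 2Kp <= e/2; adding 1 keeps the denominator positive when K = 0. *)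
pose p := e / (4 * (K + 1)).
have p0 : 0 < p by rewrite divr_gt0// mulr_gt0// ltr_wpDl.
have Kp : e / 2 + 2 * K * p <= e.
  have : p * (K + 1) = e / 4.
    by rewrite /p; field; rewrite gt_eqF// ltr_wpDl.
  rewrite mulrDr mulr1 => pK; have := ltW p0; lra.
(* If k(t)/t <= s, each coordinate fails with probability at most 2s/r^2 = p/(2(n+1)), so all [n]
   together cost at most p/2. Using [n.+1] covers n = 0. *)
pose s := p * r ^+ 2 / (4 * n.+1%:R).
have s0 : 0 < s by rewrite divr_gt0// mulr_gt0// exprn_gt0.
have small b : 0 < b -> \forall x \near +oo, k x / x <= b.
  move=> b0; move/cvgrPdist_le : k_small => /(_ b b0); apply: filterS => x.
  by rewrite sub0r normrN; apply: le_trans; exact: ler_norm.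
have large b : \forall x \near +oo, b <= k x by move/cvgryPge : k_infty; exact.
near=> t.
have t0 : 0 < t by near: t; exact: nbhs_pinfty_gt.
have kt1 : 1 <= k t by near: t; exact: large.
(* This makes [k(t) u_i] at least 1, so that it is a successor; the next bound gives 2 [k(t) u_i] <=
   t, the condition for geometric growth. *)
have ktu : forall i, (u i)^-1 <= k t.
  by near: t; apply: filter_forall => i; exact: large.
have ktt : forall i, k t / t <= (2 * u i)^-1.
  by near: t; apply: filter_forall => i; apply: small; rewrite invr_gt0 mulr_gt0.
have kts : k t / t <= s by near: t; exact: small.
have [N PN] := walk_tail hxi t (divr_gt0 p0 (ltr0n _ 2)).
pose m i := (Num.truncn (k t * u i)).-1.
have mE i : Num.truncn (k t * u i) = (m i).+1.
  by rewrite prednK// truncn_gt0 -ler_pdivrMr// div1r.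
have mt i : 2 * (m i).+1%:R <= t.
  apply: (@le_trans _ _ (2 * (k t * u i))).
    by rewrite ler_wpM2l// -mE truncn_le mulr_ge0// ltW.
  by have := ktt i; rewrite ler_pdivrMr// mulrC ler_pdivlMr ?mulr_gt0// mulrCA.
pose c2 i : R := (Num.truncn (k t))%:R * ((m i)`!%:R ^+ 2 / t ^+ (m i + m i).+1).
pose bad i := large_dev xi (m i) t N (r ^+ 2 / c2 i).
pose late := [set w | Swalk (xi^~ w) N <= t].
(* The three parts have probability at most p/2, at most p/2 and 0. *)
pose E := (\big[setU/set0]_(i < n) bad i) `|` (late `|` negative_increment xi).
have mbad i : measurable (bad i) by exact: (measurable_large_dev hxi).
have mbads : measurable (\big[setU/set0]_(i < n) bad i) by exact: bigsetU_measurable.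
have mlate : measurable late.
  rewrite /late -[X in measurable X]setTI; apply: measurable_fun_le => //.
  exact: measurable_Swalk.
have mneg := measurable_negative_increment hxi.
have Pbad i : (P (bad i) <= (p / (2 * n.+1%:R))%:E)%E.
  have tr0 : 0 < (Num.truncn (k t))%:R :> R by rewrite ltr0n truncn_gt0.
  have c20 : 0 < c2 i.
    by rewrite /c2 mulr_gt0// divr_gt0 ?exprn_gt0// ltr0n fact_gt0.
  apply: le_trans (prob_large_dev hxi _ _ _ _) _.
    by rewrite divr_gt0// exprn_gt0.
  rewrite lee_fin invf_div mulrA ler_pdivrMr ?exprn_gt0//.
  have -> : p / (2 * n.+1%:R) * r ^+ 2 = 2 * s.
    by rewrite /s; field.
  apply: (@le_trans _ _ (k t * (2 / t))); last by rewrite mulrCA ler_wpM2l.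
  rewrite mulrC /c2 -mulrA; apply: ler_pM => //.
  - by rewrite mulr_ge0 ?moment_sum_ge0// divr_ge0// exprn_ge0// ltW.
  - by rewrite truncn_le ltW.
  - exact: scaled_moment_sum_le.
have PE : (P E <= p%:E)%E.
  apply: (@le_trans _ _ ((p / 2)%:E + ((p / 2)%:E + 0))%E); last first.
    by rewrite adde0 -EFinD lee_fin; lra.
  apply: (@le_trans _ _ (P (\big[setU/set0]_(i < n) bad i) +
      (P late + P (negative_increment xi)))%E).
    apply: (@le_trans _ _ (P (\big[setU/set0]_(i < n) bad i) +
        P (late `|` negative_increment xi))%E).
      by apply: measureU2 => //; exact: measurableU.
    by apply: leeD2l; exact: measureU2.
  rewrite prob_negative_increment//; apply: leeD; last exact: leeD2r.
  apply: le_trans (measure_bigsetU_le P _ mbad) _.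
  apply: (@le_trans _ _ (\sum_(i < n) (p / (2 * n.+1%:R))%:E)%E).
    by apply: lee_sum => i _; exact: Pbad.
  rewrite sumEFin lee_fin sumr_const card_ord -mulr_natr.
  have n1 : (n%:R : R) <= n.+1%:R by rewrite ler_nat.
  rewrite [X in X <= _](_ : _ = p / 2 * (n%:R / n.+1%:R)); last by field.
  apply: (@le_trans _ _ (p / 2 * 1)); last by rewrite mulr1 ?mul1r.
  by apply: ler_wpM2l; [rewrite divr_ge0// ltW|rewrite ler_pdivrMr ?mul1r].
have mE' : measurable E by apply: measurableU => //; exact: measurableU.
have near0 w : ~ E w ->
    `|f (\row_(i < n) Xproc k (fun v => xi v w) t (u i)) - f 0| <= e / 2.
  move=> /not_orP[nbad /not_orP[nlate nneg]].
  have xi0 v : 0 <= xi v w.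
    rewrite leNgt; apply/negP => xv; apply: nneg; exists (pickle v) => //.
    by rewrite /mkset pickleK.
  apply: fr => i; rewrite mxE; apply: (small_Xproc (N := N) (m := m i)) => //.
    by rewrite ltNge; apply/negP.
  by move=> H; apply: nbad; rewrite (bigD1 i)//=; left.
have [I IE Ile] := integral_near_cst mE' (fun w => fK _) (fK 0) near0
  (ltW (divr_gt0 e0 (ltr0n _ 2))) PE.
by exists I => //; apply: le_trans Ile Kp.
Unshelve. all: by end_near.
Qed.
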